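(* Let $\mathcal{H}$ be a hereditary graph property. The following are equivalent. (1) There are constants $C,C'>0$ such that $Tw(\epsilon^{-C})\leq M_{\mathcal{H}}(\epsilon)\leq Tw(\epsilon^{-C'})$ for all sufficiently small $\epsilon>0$. (2) For all $k\geq 1$, $U(k)\in \text{Bip}(\mathcal{H})$. (3) $\mathcal{H}$ has infinite VC-dimension.
   Context: Graphs are $G=(V,E)$ with $E\subseteq\binom V2$; a hereditary graph property is a class of finite graphs closed under isomorphism and induced subgraphs. For nonempty $X,Y\subseteq V$, $d_G(X,Y)=|\{(x,y)\in X\times Y:xy\in E\}|/(|X||Y|)$; $(X,Y)$ is $\epsilon$-regular if $|d_G(X,Y)-d_G(X',Y')|\le\epsilon$ for all $X'\subseteq X,Y'\subseteq Y$ with $|X'|\ge\epsilon|X|,|Y'|\ge\epsilon|Y|$; a partition $\mathcal P$ of $V$ is $\epsilon$-regular if at least $(1-\epsilon)|V|^2$ pairs $(x,y)\in V^2$ lie in $X\times Y$ for some $\epsilon$-regular $(X,Y)\in\mathcal P^2$. $M_{\mathcal H}(\epsilon)$ is the least integer $M$ such that all sufficiently large graphs in $\mathcal H$ have $\epsilon$-regular partitions with at most $M$ parts. $Tw(1)=1$, $Tw(i)=2^{Tw(i-1)}$. For a graph $G=(V,E)$, $\text{Bip}(G)$ is the bipartite graph with vertex set $\{u_v:v\in V\}\cup\{w_v:v\in V\}$ and edges $u_vw_{v'}$ for $vv'\in E$; $\text{Bip}(\mathcal H)$ is the closure of $\{\text{Bip}(G):G\in\mathcal H\}$ under isomorphism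 and induced subgraphs. $U(k)$ is the bipartite graph with vertices $a_1,\dots,a_k$ and $b_S$ ($S\subseteq[k]$) and edges $a_ib_S$ for $i\in S$. The VC-dimension of a graph $G$ is the largest $k$ for which there are vertices $a_i$ ($i\in[k]$), $b_S$ ($S\subseteq[k]$) of $G$ with $a_ib_S\in E$ iff $i\in S$; the VC-dimension of $\mathcal H$ is the supremum over $G\in\mathcal H$. *)

(* Defs.v *)
From HB Require Import structures.
From mathcomp Require Import all_boot all_order all_algebra.
From mathcomp Require Import boolp classical_sets reals exp.
Set Implicit Arguments. Unset Strict Implicit. Unset Printing Implicit Defensive.
Import Order.TTheory GRing.Theory Num.Theory.
Local Open Scope ring_scope.

Definition simple_graph n (e : rel 'I_n) := symmetric e /\ irreflexive e.

Definition gclass := forall n : nat, rel 'I_n -> Prop.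

Definition induced_in (T S : finType) (e : rel T) (e' : rel S) :=
  exists f : T -> S, injective f /\ forall x y, e x y = e' (f x) (f y).

Definition hereditary (H : gclass) :=
  (forall n e, H n e -> simple_graph e) /\
  (forall m n (e' : rel 'I_m) (e : rel 'I_n),
      H n e -> induced_in e' e -> H m e').

Section Regularity.
Variable R : realType.

Definition density n (e : rel 'I_n) (X Y : {set 'I_n}) : R :=
  #|[set p in finset.setX X Y | e p.1 p.2]|%:R / (#|X| * #|Y|)%:R.

Definition regular_pair n (e : rel 'I_n) (eps : R) (X Y : {set 'I_n}) : bool :=
  [forall X' : {set 'I_n}, forall Y' : {set 'I_n},
     [&& X' \subset X, Y' \subset Y, eps * #|X|%:R <= #|X'|%:R
       & eps * #|Y|%:R <= #|Y'|%:R] ==>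
     (`|density e X Y - density e X' Y'| <= eps)].

Definition regular_partition n (e : rel 'I_n) (eps : R)
    (P : {set {set 'I_n}}) : bool :=
  finset.partition P [set: 'I_n] &&
  ((1 - eps) * (n ^ 2)%N%:R <=
   #|[set p : 'I_n * 'I_n | [exists X in P, exists Y in P,
        [&& p.1 \in X, p.2 \in Y & regular_pair e eps X Y]]]|%:R).

Definition M_bound (H : gclass) (eps : R) (M : nat) :=
  exists N : nat, forall n (e : rel 'I_n), (N <= n)%N -> H n e ->
    exists P : {set {set 'I_n}}, regular_partition e eps P /\ (#|P| <= M)%N.

Definition M_H (H : gclass) (eps : R) : nat :=
  xget 0%N [set M | M_bound H eps M /\ forall M', M_bound H eps M' -> (M <= M')%N].

(* Tower function Tw(1)=1, Tw(i)=2^Tw(i-1); Tw(0):=1 by convention. *)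
Fixpoint tw (i : nat) : nat :=
  if i is i'.+1 then (if i' is 0 then 1 else 2 ^ tw i')%N else 1%N.

Definition twR (x : R) : nat := tw `|Num.ceil x|%N.

End Regularity.

Definition bip_adj n (e : rel 'I_n) : rel ('I_n + 'I_n) :=
  fun a b => match a, b with
             | inl v, inr v' => e v v'
             | inr v', inl v => e v v'
             | _, _ => false
             end.

Definition in_Bip (H : gclass) (T : finType) (e : rel T) :=
  exists n (G : rel 'I_n), H n G /\ induced_in e (bip_adj G).

Definition U_adj k : rel ('I_k + {set 'I_k}) :=
  fun a b => match a, b with
             | inl i, inr s => i \in s
             | inr s, inl i => i \in s
             | _, _ => false
             end.

Definition vc_witness n (e : rel 'I_n) (k : nat) :=
  exists (a : 'I_k -> 'I_n) (b : {set 'I_k} -> 'I_n),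
    forall i s, e (a i) (b s) = (i \in s).

Definition infinite_VC (H : gclass) :=
  forall k : nat, exists n (e : rel 'I_n), H n e /\ vc_witness e k.

(* Main.v *)
(* Infinite VC-dimension forces a tower.  A hereditary class of infinite
   VC-dimension contains, between two disjoint vertex sets, every bipartite
   pattern.  Take [s] blocks on either side, each with a chain of [s] partitions
   whose numbers of parts grow exponentially at every step, and let the pair of
   blocks (a, b) only see level r = a + b mod s: a level-r cell X is cut in half
   by every level-r cell Y of the opposite block, following a binary code, and
   so is Y by X, the halves being joined completely or not at all.  A part of a
   regular partition which has a substantial share in a level-r cell must have
   most of it in one level-(r+1) cell, since otherwise a fixed proportion of the
   cells Y split that share and exhibit pairs of subsets of densities 0 and 1.
   Climbing through the s levels costs little in total, so the number of parts
   is at least about the number of level-s cells.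

   The tower upper bound is the energy increment argument, the energy being the
   squared L2 norm of the conditional expectation of the edge indicator.

   With VC-dimension bounded by k, the Sauer-Shelah lemma bounds the size of a
   family of vertices with pairwise very different neighbourhoods; grouping the
   vertices around a maximal such family gives pairs of cells which mostly have
   density close to 0 or 1, hence a regular partition whose number of parts is
   only exponential in a power of 1 / epsilon. *)
Require Import Defs.
From HB Require Import structures.
From mathcomp Require Import all_boot all_order all_algebra.
From mathcomp Require Import boolp reals exp.
From mathcomp Require Import zify ring lra.
Set Implicit Arguments. Unset Strict Implicit. Unset Printing Implicit Defensive.
Import Order.TTheory GRing.Theory Num.Theory.
Local Open Scope ring_scope.

(** * Binary codes and splitting *)

Definition symdiff (T : finType) (A B : {set T}) : {set T} :=
  [set x | (x \in A) != (x \in B)].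

Lemma symdiffC (T : finType) (A B : {set T}) : symdiff A B = symdiff B A.
Proof. by apply/setP => x; rewrite !inE eq_sym. Qed.

Lemma symdiffxx (T : finType) (A : {set T}) : symdiff A A = finset.set0.
Proof. by apply/setP => x; rewrite !inE eqxx. Qed.

Lemma symdiff_triangle (T : finType) (A B C : {set T}) :
  (#|symdiff A C| <= #|symdiff A B| + #|symdiff B C|)%N.
Proof.
apply: leq_trans (leq_card_setU _ _); apply: subset_leq_card; apply/subsetP => x.
by rewrite !inE; case: (x \in A); case: (x \in B); case: (x \in C).
Qed.

Lemma symdiff_inj (T : finType) (A : {set T}) : injective (symdiff A).
Proof.
move=> B B' /setP h; apply/setP => x; move: (h x); rewrite !inE.
by case: (x \in A); case: (x \in B); case: (x \in B').
Qed.

Lemma sum_exp_card_setC (T : finType) :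
  (\sum_(S : {set T}) 2 ^ (#|T| - #|S|) = 3 ^ #|T|)%N.
Proof.
transitivity (\prod_(i : T) (1 + 2))%N; last by rewrite prod_nat_const.
rewrite bigA_distr; apply: eq_big => S; first by rewrite inE.
rewrite (bigID (mem S)) /= big1 ?mul1n; last by move=> i ->.
rewrite (eq_bigr (fun=> 2%N)); last by move=> i /negbTE ->.
by rewrite prod_nat_const -(cardC (mem S)) addKn.
Qed.

(** A Chernoff bound by weighting: each such set contributes at least [2 ^ (6 * j)] to the expansion
    of [3 ^ (8 * j)], and 3^8 = 6561 is below 2^13. *)
Lemma card_small_sets (j : nat) : (0 < j)%N ->
  (#|[set S : {set 'I_(8 * j)} | #|S| < 2 * j]| * 2 ^ j < 2 ^ (8 * j))%N.
Proof.
move=> j0; set B := [set S | _].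
have h : (#|B| * 2 ^ (6 * j) <= 3 ^ (8 * j))%N.
  have := sum_exp_card_setC 'I_(8 * j); rewrite card_ord => <-.
  rewrite (bigID (mem B)) /= -sum_nat_const; apply: leq_trans (leq_addr _ _).
  apply: leq_sum => S; rewrite inE => hS; rewrite leq_exp2l //.
  by move: hS; set c := #|S| => hS; lia.
rewrite -(ltn_pmul2r (_ : 0 < 32 ^ j)%N) ?expn_gt0 //.
have -> : (#|B| * 2 ^ j * 32 ^ j = #|B| * 2 ^ (6 * j))%N.
  by rewrite -mulnA -expnMn [in RHS]expnM.
apply: leq_ltn_trans h _.
by rewrite !expnM -expnMn ltn_exp2r.
Qed.

(* Gilbert-Varshamov: the balls around fewer than [2 ^ j] words cannot cover the cube. *)
Lemma exists_code (j : nat) : (0 < j)%N ->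
  exists c : nat -> {set 'I_(8 * j)},
    forall p q, (p < q < 2 ^ j)%N -> (2 * j <= #|symdiff (c p) (c q)|)%N.
Proof.
move=> j0.
suff h : forall k, (k <= 2 ^ j)%N -> exists c : nat -> {set 'I_(8 * j)},
    forall p q, (p < q < k)%N -> (2 * j <= #|symdiff (c p) (c q)|)%N.
  exact: h.
elim=> [_|k IH hk]; first by exists (fun=> finset.set0) => p q; rewrite ltn0 andbF.
have [c hc] := IH (ltnW hk).
pose near (p : nat) A := (#|symdiff (c p) A| < 2 * j)%N.
(* Symmetric difference with [c p] carries the ball around [c p] into the ball around the empty
   set. *)
have hball p : (#|[set A | near p A]| <= #|[set S : {set 'I_(8 * j)} | #|S| < 2 * j]|)%N.
  rewrite -(card_imset _ (@symdiff_inj _ (c p))).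
  apply: subset_leq_card; apply/subsetP => S /imsetP[A].
  by rewrite !inE => hA ->.
have [A hA] : exists A, [forall p : 'I_k, ~~ near p A].
  apply/existsP; apply: contraT => /existsPn /= hcov.
  suff : (2 ^ (8 * j) <= #|[set S : {set 'I_(8 * j)} | #|S| < 2 * j]| * 2 ^ j)%N.
    by rewrite leqNgt card_small_sets.
  have -> : (2 ^ (8 * j) = \sum_(A : {set 'I_(8 * j)}) 1)%N.
    by rewrite sum1_card -cardsT -powersetT card_powerset cardsT card_ord.
  apply: (@leq_trans (\sum_(A : {set 'I_(8 * j)}) \sum_(p < k) near p A)%N).
    apply: leq_sum => A _; have := hcov A; rewrite negb_forall => /existsP[p].
    by rewrite negbK => hp; rewrite (bigD1 p) //= hp.
  rewrite exchange_big /=.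
  apply: (@leq_trans (\sum_(p < k) #|[set S : {set 'I_(8 * j)} | #|S| < 2 * j]|)%N).
    apply: leq_sum => p _; apply: leq_trans (hball p).
    by rewrite -sum1dep_card [leqRHS]big_mkcond /= leq_sum // => A _; case: near.
  by rewrite sum_nat_const card_ord mulnC leq_mul2l (ltnW hk) orbT.
exists (fun x => if x == k then A else c x) => p q /andP[pq].
rewrite ltnS leq_eqVlt => /orP[/eqP qk|qk].
  rewrite qk eqxx ltn_eqF -?qk // leqNgt.
  by have /forallP/(_ (Ordinal (leq_trans pq (eq_leq qk)))) := hA.
rewrite !ltn_eqF //; first by apply: hc; rewrite pq.
exact: ltn_trans pq qk.
Qed.

Section Splitting.
Variables (V : finType) (L : nat) (f : V -> {set 'I_L}) (C : {set V}).

Local Notation side b i := #|[set v in C | (i \in f v) == b]|.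

Lemma sum_sides i : (side true i + side false i = #|C|)%N.
Proof.
rewrite -(cardsID [set v | i \in f v] C); congr (_ + _)%N; apply: eq_card => v.
  by rewrite !inE eqb_id.
by rewrite !inE eqbF_neg andbC.
Qed.

Lemma larger_side i : exists b, (#|C| <= 2 * side b i)%N.
Proof.
have := sum_sides i; case: (leqP #|C| (2 * side true i)) => h hs; first by exists true.
by exists false; lia.
Qed.

(** Both sides count the triples [(v, w, i)] in which coordinate [i] tells [v] from [w]. *)
Lemma double_count_sides :
  (\sum_(v in C) \sum_(w in C) #|symdiff (f v) (f w)| =
   \sum_i 2 * (side true i * side false i))%N.
Proof.
under eq_bigr => v _.
  under eq_bigr => w _ do rewrite -sum1dep_card big_mkcond /=.
  rewrite exchange_big; over.
rewrite exchange_big; apply: eq_bigr => i _ /=.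
have h b : (\sum_(w in C) (if (i \in f w) != b then 1 else 0) = side (~~ b) i)%N.
  rewrite -big_mkcondr /= sum1dep_card; apply: eq_card => w.
  by rewrite !inE; case: (i \in f w); case: b.
under eq_bigr => v _.
  under eq_bigr => w _ do rewrite eq_sym.
  rewrite h; over.
rewrite (bigID (fun v => i \in f v)) /= mul2n -addnn; congr (_ + _)%N.
  rewrite (eq_bigr (fun=> side false i)); last by move=> v /andP[_ ->].
  rewrite sum_nat_const; congr (_ * _)%N; apply: eq_card => v.
  by rewrite !inE eqb_id unfold_in.
rewrite (eq_bigr (fun=> side true i)); last by move=> v /andP[_ /negbTE ->].
rewrite sum_nat_const mulnC; congr (_ * _)%N; apply: eq_card => v.
by rewrite !inE eqbF_neg unfold_in.
Qed.

Hypothesis code : forall v w, f v != f w -> (L <= 4 * #|symdiff (f v) (f w)|)%N.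

(* Each product of the two sides is at most [#|C| * D], where [D] is the
   number of points outside the largest fibre; their sum is [L / 8] times that. *)
Lemma many_splits (D : nat) : (0 < D)%N -> (exists v, v \in C) ->
  (forall v, v \in C -> D <= #|[set w in C | f w != f v]|)%N ->
  (L <= 16 * #|[set i | (D <= 16 * side true i)%N && (D <= 16 * side false i)%N]|)%N.
Proof.
move=> D0 [v1 v1C] hD.
pose out v := #|[set w in C | f w != f v]|.
have [v0 v0C hmin] : exists2 v0, v0 \in C & forall v, v \in C -> (out v0 <= out v)%N.
  by case: (arg_minnP out v1C) => v0 h1 h2; exists v0.
have {hD} hD : (D <= out v0)%N by exact: hD.
set E := out v0 in hmin hD.
have E0 : (0 < E)%N by exact: leq_trans D0 hD.
have C0 : (0 < #|C|)%N by apply/card_gt0P; exists v1.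
have sideC b i : (side b i <= #|C|)%N by rewrite -(sum_sides i); case: b; lia.
(* One of the two sides of [i] misses the largest fibre, that of [v0], entirely. *)
have prodE i : (side true i * side false i <= #|C| * E)%N.
  have hs b : (i \in f v0) != b -> (side b i <= E)%N.
    move=> hb; apply: subset_leq_card; apply/subsetP => w; rewrite !inE.
    move=> /andP[-> /eqP hw] /=; apply: contraNneq hb => h.
    by rewrite -hw h.
  case: (boolP (i \in f v0)) hs => _ hs; first by rewrite leq_mul ?hs.
  by rewrite mulnC leq_mul ?hs.
have low : (L * (#|C| * E) <= 8 * \sum_i (side true i * side false i))%N.
  have -> : (8 * \sum_i (side true i * side false i) =
     4 * \sum_i 2 * (side true i * side false i))%N.
    by rewrite -big_distrr /=; lia.
  rewrite -double_count_sides mulnC -mulnA -sum_nat_const big_distrr /=.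
  apply: leq_sum => v vC.
  apply: (@leq_trans (out v * L)); first by rewrite leq_mul2r hmin ?orbT.
  rewrite -sum_nat_const big_distrr /= [leqRHS](bigID (fun w => f w != f v)) /=.
  apply: leq_trans (leq_addr _ _).
  rewrite (eq_bigl (fun w => (w \in C) && (f w != f v))); last by move=> w; rewrite inE.
  by apply: leq_sum => w /andP[_ h]; apply: code; rewrite eq_sym.
set G := [set i | _].
(* A coordinate outside [G] has a side below [D / 16], so its product is at most a sixteenth of
   [#|C| * E]. Together with [low] this leaves [L <= 16 * #|G|]. *)
have up : (16 * \sum_i (side true i * side false i) <=
           16 * #|G| * (#|C| * E) + L * (#|C| * E))%N.
  rewrite (bigID (mem G)) /= mulnDr; apply: leq_add.
    rewrite -mulnA leq_mul2l /= -(sum_nat_const (mem G)); exact: leq_sum.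
  rewrite big_distrr /=.
  apply: (@leq_trans (\sum_(i | i \notin G) #|C| * E)%N).
    apply: leq_sum => i; rewrite inE negb_and -!ltnNge.
    have := sideC true i; have := sideC false i.
    move: (side true i) (side false i) #|C| hD => a b c; clear; nia.
  rewrite sum_nat_const leq_mul2r; apply/orP; right.
  by rewrite -[leqRHS](card_ord L) max_card.
have CE0 : (0 < #|C| * E)%N by rewrite muln_gt0 C0.
rewrite -(leq_pmul2r CE0).
move: low up; set x := (\sum_i _)%N; move: (L * _)%N => l; lia.
Qed.
End Splitting.

(** * Partitions and constant pairs *)

Lemma card_fibres (T I : finType) (h : T -> I) (A : {set T}) :
  (#|A| = \sum_i #|[set v in A | h v == i]|)%N.
Proof.
rewrite -sum1_card (partition_big h xpredT) //=; apply: eq_bigr => i _.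
by rewrite sum1dep_card.
Qed.

Lemma card_le_fibres (R : realType) (T I : finType) (h : T -> I) (A B : {set T}) (c : R) :
  (forall i, #|[set v in A | h v == i]|%:R <= c * #|[set v in B | h v == i]|%:R) ->
  #|A|%:R <= c * #|B|%:R.
Proof.
move=> hi; rewrite (card_fibres h A) (card_fibres h B) !natr_sum mulr_sumr.
exact: ler_sum.
Qed.

Lemma density_const (R : realType) n (e : rel 'I_n) (X Y : {set 'I_n}) (b : bool) :
  (0 < #|X|)%N -> (0 < #|Y|)%N ->
  (forall x y, x \in X -> y \in Y -> e x y = b) -> density R e X Y = b%:R.
Proof.
move=> X0 Y0 he; rewrite /density.
case: b he => he.
  rewrite (_ : [set p in _ | _] = finset.setX X Y); last first.
    apply/setP => -[x y]; rewrite !inE /=; apply/idP/idP => [/andP[]//|].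
    by move=> h; rewrite h /=; case/andP: h => *; rewrite he.
  by rewrite cardsX divff // pnatr_eq0 -lt0n muln_gt0 X0.
rewrite (_ : [set p in _ | _] = finset.set0) ?cards0 ?mul0r //.
apply/setP => -[x y]; rewrite !inE /=; apply/negbTE/negP => /andP[/andP[hx hy]].
by rewrite he.
Qed.

(** The densities 1 and 0, seen from the same [Y'], cannot both be within [eps] of the density of
    the pair. *)
Lemma irregular_of_const (R : realType) n (e : rel 'I_n) (eps : R) (X Y X1 X0 Y' : {set 'I_n}) :
  eps < 2^-1 -> (0 < #|X1|)%N -> (0 < #|X0|)%N -> (0 < #|Y'|)%N ->
  X1 \subset X -> X0 \subset X -> Y' \subset Y ->
  eps * #|X|%:R <= #|X1|%:R -> eps * #|X|%:R <= #|X0|%:R ->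
  eps * #|Y|%:R <= #|Y'|%:R ->
  (forall x y, x \in X1 -> y \in Y' -> e x y = true) ->
  (forall x y, x \in X0 -> y \in Y' -> e x y = false) ->
  ~~ regular_pair e eps X Y.
Proof.
move=> he x1 x0 y0 s1 s0 sY c1 c0 cY e1 e0; apply/negP => /forallP h.
have := h X1 => /forallP/(_ Y'); have := h X0 => /forallP/(_ Y').
rewrite s1 s0 sY c1 c0 cY /= (density_const _ x1 y0 e1) (density_const _ x0 y0 e0).
rewrite !ler_norml => /andP[_ h1] /andP[h2 _].
by move: h1 h2 he => /=; lra.
Qed.

Section PartitionBlocks.
Variables (n : nat) (P : {set {set 'I_n}}).
Hypothesis hP : finset.partition P [set: 'I_n].

Lemma partition_cover v : v \in cover P.
Proof. by rewrite (cover_partition hP). Qed.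

Lemma mem_pblock_eq v w : (w \in pblock P v) = (pblock P w == pblock P v).
Proof.
by rewrite [RHS]eq_sym eq_pblock ?partition_cover //; case/and3P: hP.
Qed.

Lemma pblock_in v : pblock P v \in P.
Proof. exact/pblock_mem/partition_cover. Qed.

Lemma regular_partition_pblock (R : realType) (e : rel 'I_n) (eps : R) :
  regular_partition e eps P =
  ((1 - eps) * (n ^ 2)%N%:R <=
   #|[set p : 'I_n * 'I_n | regular_pair e eps (pblock P p.1) (pblock P p.2)]|%:R).
Proof.
rewrite /regular_partition hP /=; congr (_ <= _%:R); apply: eq_card => -[v w].
have [_ tP _] := and3P hP.
rewrite !inE /=; apply/existsP/idP => [[X /andP[XP /existsP[Y /and4P[YP vX wY]]]]|h].
  by rewrite (def_pblock tP XP vX) (def_pblock tP YP wY).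
exists (pblock P v); rewrite pblock_in; apply/existsP; exists (pblock P w).
by rewrite pblock_in !mem_pblock !partition_cover.
Qed.

Lemma card_irregular_pairs (R : realType) (e : rel 'I_n) (eps : R) :
  regular_partition e eps P ->
  #|[set p : 'I_n * 'I_n | ~~ regular_pair e eps (pblock P p.1) (pblock P p.2)]|%:R
    <= eps * (n ^ 2)%:R.
Proof.
rewrite regular_partition_pblock => h.
have := cardC [set p : 'I_n * 'I_n | regular_pair e eps (pblock P p.1) (pblock P p.2)].
rewrite card_prod card_ord mulnn => hc; move: h; rewrite -hc natrD.
rewrite [X in _ + X%:R](_ : _ = #|[set p : 'I_n * 'I_n |
  ~~ regular_pair e eps (pblock P p.1) (pblock P p.2)]|); last first.
  by apply: eq_card => p; rewrite !inE.
move: #|_| #|_| => a b; lra.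
Qed.
End PartitionBlocks.

(** * The tower lower bound *)

Definition residue (L : nat) (L0 : (0 < L)%N) (x : nat) : 'I_L := Ordinal (ltn_pmod x L0).

Lemma card_residue_class (L N : nat) (L0 : (0 < L)%N) (I : {set 'I_L}) : (L %| N)%N ->
  (L * #|[set x : 'I_N | residue L0 x \in I]| = N * #|I|)%N.
Proof.
case/dvdnP => q ->; pose F x : nat := residue L0 x \in I.
have h k : (\sum_(0 <= x < k * L) F x = k * \sum_(0 <= x < L) F x)%N.
  elim: k => [|k IH]; first by rewrite !mul0n big_geq.
  rewrite mulSn (@big_cat_nat _ _ _ (k * L)) /= ?leq_addl // IH mulSn addnC; congr (_ + _)%N.
  rewrite -[X in \sum_(X <= _ < _) _]add0n big_addn addnK; apply: eq_bigr => x _.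
  congr (nat_of_bool (_ \in I)); apply: val_inj; rewrite /= addnC modnMDl //.
rewrite -sum1dep_card big_mkcond /= -(big_mkord xpredT F) h mulnA [(L * q)%N]mulnC.
congr (_ * _)%N; rewrite big_mkord -sum1_card [RHS]big_mkcond /=.
apply: eq_bigr => i _; rewrite /F.
by rewrite (_ : residue L0 i = i) //; apply: val_inj; rewrite /= modn_small.
Qed.

(** The factor is the number of codewords supplied by [exists_code]: every level-r cell is divided
    into [2 ^ half_tower r] subcells with different codewords. *)
Fixpoint half_tower (r : nat) : nat :=
  if r is r'.+1 then (half_tower r' * 2 ^ half_tower r')%N else 1%N.

Lemma half_tower_gt0 r : (0 < half_tower r)%N.
Proof. by elim: r => //= r IH; rewrite muln_gt0 IH expn_gt0. Qed.

Lemma tw_le_half_tower r : (tw r.+1 <= half_tower r)%N.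
Proof.
elim: r => // r IH; apply: (@leq_trans (2 ^ half_tower r)); first by rewrite leq_exp2l.
by rewrite leq_pmull ?half_tower_gt0.
Qed.

(** This is both the number of level-r cells of a block and the length of the level-r codewords,
    whose coordinates are the cells of the opposite block. *)
Definition levels r := (8 * half_tower r)%N.

Lemma levels_gt0 r : (0 < levels r)%N.
Proof. by rewrite muln_gt0 half_tower_gt0. Qed.

Lemma levelsS r : levels r.+1 = (levels r * 2 ^ half_tower r)%N.
Proof. by rewrite /levels mulnA. Qed.

Lemma dvdn_levels r s : (r <= s)%N -> (levels r %| levels s)%N.
Proof.
move=> /subnK <-; elim: (s - r)%N => // k IH.
by rewrite addSn levelsS dvdn_mulr.
Qed.

Definition level_residue r x := residue (levels_gt0 r) x.
Definition subindex r x := ((x %/ levels r) %% 2 ^ half_tower r)%N.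

(** In mixed radix, the remainder modulo [levels r.+1] consists of the remainder modulo [levels r]
    and the next digit [subindex r]. *)
Lemma level_residueS r x y : level_residue r x = level_residue r y ->
  subindex r x = subindex r y -> level_residue r.+1 x = level_residue r.+1 y.
Proof.
move=> /(congr1 val) /= h1 h2; apply: val_inj => /=.
have E z : (z %% levels r.+1 = subindex r z * levels r + z %% levels r)%N.
  rewrite /subindex levelsS {1}(divn_eq z (levels r)).
  rewrite {1}(divn_eq (z %/ levels r) (2 ^ half_tower r)).
  rewrite mulnDl -mulnA -addnA [(2 ^ _ * _)%N]mulnC modnMDl modn_small //.
  apply: (@leq_trans ((z %/ levels r %% 2 ^ half_tower r).+1 * levels r)).
    by rewrite mulSn addnC ltn_add2r ltn_pmod ?levels_gt0.
  by rewrite mulnC leq_mul2l ltn_pmod ?expn_gt0 // orbT.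
by rewrite !E h1 h2.
Qed.

Lemma bernoulli_pow (R : realType) (x : R) k : 0 <= x -> x <= 1 -> 1 - k%:R * x <= (1 - x) ^+ k.
Proof.
move=> x0 x1; elim: k => [|k IH]; first by rewrite mul0r subr0.
have hk : 0 <= k%:R * x ^+ 2 by rewrite mulr_ge0 ?exprn_ge0.
rewrite exprS -natr1; apply: le_trans (ler_wpM2l _ IH); last by lra.
by rewrite expr2 in hk; nra.
Qed.

(** Arithmetic of a split cell: the cell, of size [x], is a share [t] of a part of size [a]; [o]
    counts its vertices outside the largest codeword class, and [y] is a side of it. The shares
    multiply to d^2/2 * d^2/16 = d^4/32. *)
Lemma threshold_share (R : realType) (eta d t a x y o : R) : 0 <= a -> 0 <= d ->
  eta <= d ^+ 4 / 32 -> d ^+ 2 / 2 <= t -> t * a <= x -> d ^+ 2 * x <= o ->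
  o <= 16 * y -> eta * a <= y.
Proof.
move=> a0 d0 h1 h2 h3 h4 h5.
have h6 : d ^+ 2 / 2 * a <= x by apply: le_trans h3; apply: ler_wpM2r.
have h7 : d ^+ 2 * (d ^+ 2 / 2 * a) <= d ^+ 2 * x.
  by apply: ler_wpM2l => //; apply: sqr_ge0.
have h8 : eta * a <= d ^+ 4 / 32 * a by apply: ler_wpM2r.
have e4 : d ^+ 4 = d ^+ 2 * d ^+ 2 by rewrite -exprD.
by rewrite e4 in h8; lra.
Qed.

Lemma threshold_half (R : realType) (eta d t a x y : R) : 0 <= a -> 0 <= d -> d <= 1 ->
  eta <= d ^+ 4 / 32 -> d ^+ 2 / 2 <= t -> t * a <= x -> x <= 2 * y -> eta * a <= y.
Proof.
move=> a0 d0 d1 h1 h2 h3 h4.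
have h6 : d ^+ 2 / 2 * a <= x by apply: le_trans h3; apply: ler_wpM2r.
have h7 : eta * a <= d ^+ 4 / 32 * a by apply: ler_wpM2r.
have h8 : d ^+ 4 * a <= d ^+ 2 * a.
  by apply: ler_wpM2r => //; apply: ler_wiXn2l.
have h9 : 0 <= d ^+ 2 * a by rewrite mulr_ge0 ?sqr_ge0.
by lra.
Qed.

(** * Light, heavy and split cells of a regular partition of the tower pattern *)

Section LowerBound.
Variables (R : realType) (code : forall r, nat -> {set 'I_(levels r)}).
Hypothesis code_dist : forall r p q, (p < q < 2 ^ half_tower r)%N ->
  (2 * half_tower r <= #|symdiff (code r p) (code r q)|)%N.

Definition codeword r x := code r (subindex r x).

Lemma subindex_dist r x y : subindex r x != subindex r y ->
  (2 * half_tower r <= #|symdiff (codeword r x) (codeword r y)|)%N.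
Proof.
have lt z : (subindex r z < 2 ^ half_tower r)%N by rewrite ltn_pmod ?expn_gt0.
rewrite neq_ltn => /orP[] h; last rewrite symdiffC.
  by apply: code_dist; rewrite h lt.
by apply: code_dist; rewrite h lt.
Qed.

Lemma codeword_dist r x y : codeword r x != codeword r y ->
  (levels r <= 4 * #|symdiff (codeword r x) (codeword r y)|)%N.
Proof.
move=> h; have /subindex_dist : subindex r x != subindex r y.
  by apply: contraNneq h => h; rewrite /codeword h.
rewrite /levels; lia.
Qed.

Lemma codeword_inj r x y : codeword r x = codeword r y -> subindex r x = subindex r y.
Proof.
move=> h; apply/eqP; apply: contraT => /subindex_dist.
by rewrite h symdiffxx cards0 leqn0 muln_eq0 /= -[_ == _]negbK -lt0n half_tower_gt0.
Qed.

(** The bit of [x] at the cell of [y] is compared with the bit of [y] at the cell of [x]. This is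
    symmetric, and once the bit of [y] is fixed, the edge is decided by the bit of [x]. *)
Definition tower_pattern s (a b x y : nat) : bool :=
  let r := ((a + b) %% s)%N in
  (level_residue r y \in codeword r x) == (level_residue r x \in codeword r y).

Variables (s N n : nat) (e : rel 'I_n) (g : 'I_n -> bool * ('I_s * 'I_N)).
Hypotheses (g_bij : bijective g) (s0 : (0 < s)%N) (N0 : (0 < N)%N)
  (dvdN : (levels s %| N)%N).

Local Notation side v := (g v).1.
Local Notation blk v := (g v).2.1.
Local Notation pos v := (g v).2.2.

Hypothesis he : forall v w, side v != side w ->
  e v w = tower_pattern s (blk v) (blk w) (pos v) (pos w).

Definition label r v := (side v, blk v, level_residue r (pos v)).

Lemma card_vertices : n = (2 * s * N)%N.
Proof.
have /bij_eq_card := g_bij; rewrite card_ord card_prod card_bool card_prod !card_ord.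
by rewrite mulnA.
Qed.

Lemma card_block (c : bool) (b : 'I_s) (r : nat) (I : {set 'I_(levels r)}) : (r <= s)%N ->
  (levels r * #|[set w | [&& side w == c, blk w == b & level_residue r (pos w) \in I]]|
   = N * #|I|)%N.
Proof.
move=> rs; rewrite -(@card_residue_class _ _ (levels_gt0 r)); last first.
  exact: dvdn_trans (dvdn_levels rs) dvdN.
congr (_ * _)%N; have [h gK hK] := g_bij.
rewrite -(card_imset _ (_ : injective (fun x : 'I_N => h (c, (b, x))))).
  apply: eq_card => w; rewrite !inE; apply/and3P/imsetP => [[/eqP h1 /eqP h2 h3]|[x]].
    exists (pos w); first by rewrite inE.
    by rewrite -h1 -h2 -{1}[w]gK; case: (g w) => ? [].
  by rewrite inE => hx ->; rewrite hK /= !eqxx.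
by move=> x y /(can_inj hK)[].
Qed.

Lemma card_label_class (v : 'I_n) :
  (levels s * #|[set w | label s w == label s v]| = N)%N.
Proof.
rewrite -[RHS]muln1 -(cards1 (level_residue s (pos v))).
rewrite -(card_block (side v) (blk v)) //; congr (_ * _)%N.
by apply: eq_card => w; rewrite !inE !xpair_eqE -andbA.
Qed.

Variables (P : {set {set 'I_n}}) (eps : R).
Hypotheses (hP : finset.partition P [set: 'I_n]) (hreg : regular_partition e eps P).

Local Notation part v := (pblock P v).
Definition cell r v := [set w in part v | label r w == label r v].

(* [u * n] bounds the number of light vertices at every level; the threshold
   decreases because a cell which is not split keeps all but a share [u ^+ 2] of
   its vertices in a single cell of the next level. *)
Let u : R := (64 * s)%:R^-1.
Definition threshold r : R := u ^+ 2 * (1 - u ^+ 2) ^+ r.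
Definition heavy r := [set v | threshold r * #|part v|%:R <= #|cell r v|%:R].
(** Quantifying over all [q] says that even the largest codeword class misses a share [u ^+ 2] of
    the cell. *)
Definition split r := [set v in heavy r | [forall q in cell r v,
  u ^+ 2 * #|cell r v|%:R <=
    #|[set w in cell r v | codeword r (pos w) != codeword r (pos q)]|%:R]].

Hypothesis heps : eps <= u ^+ 4 / 32.
Hypothesis eps0 : 0 < eps.

Lemma u_gt0 : 0 < u.
Proof. by rewrite invr_gt0 ltr0n muln_gt0. Qed.

Lemma us : u * s%:R = 64^-1.
Proof. by rewrite /u natrM invfM mulfVK // pnatr_eq0 -lt0n. Qed.

Lemma u_le : u <= 64^-1.
Proof. by rewrite -us ler_peMr ?(ltW u_gt0) // ler1n. Qed.

(** By Bernoulli's inequality and [r * u <= 1/64], the [r] factors together lose at most half. *)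
Lemma threshold_ge r : (r <= s)%N -> u ^+ 2 / 2 <= threshold r.
Proof.
move=> rs; have u0 := u_gt0; have ul := u_le.
apply: ler_wpM2l; first exact: sqr_ge0.
have h : 1 - r%:R * u ^+ 2 <= (1 - u ^+ 2) ^+ r by apply: bernoulli_pow; nra.
apply: le_trans h; have : r%:R * u <= 64^-1.
  by rewrite -us mulrC ler_pM2l // ler_nat.
by rewrite expr2; nra.
Qed.

Lemma thresholdS r : threshold r.+1 = threshold r * (1 - u ^+ 2).
Proof. by rewrite /threshold [_ ^+ r.+1]exprSr mulrA. Qed.

Lemma mem_cell r v w : (w \in cell r v) = (part w == part v) && (label r w == label r v).
Proof. by rewrite inE (mem_pblock_eq hP). Qed.

Lemma mem_cell_refl r v : v \in cell r v.
Proof. by rewrite mem_cell !eqxx. Qed.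

Lemma card_cell_gt0 r v : (0 < #|cell r v|)%N.
Proof. by apply/card_gt0P; exists v; apply: mem_cell_refl. Qed.

Lemma cellE r v : cell r v =
  [set w in [set: 'I_n] | (part w, label r w) == (part v, label r v)].
Proof. by apply/setP => w; rewrite mem_cell !inE xpair_eqE. Qed.

(* The light cells of a part [Z] with a fixed label have total size at most [threshold * #|Z|]. *)
Lemma card_light0 : #|~: heavy 0|%:R <= u / 4 * n%:R.
Proof.
(* There are [16 * s] labels of level 0, and [16 * s * u ^+ 2] is [u / 4]. *)
have -> : u / 4 * n%:R = \sum_(l : bool * 'I_s * 'I_(levels 0)) u ^+ 2 * n%:R.
  rewrite sumr_const !card_prod card_bool !card_ord -[RHS]mulr_natl mulrA; congr (_ * _).
  rewrite !natrM; have := us; rewrite expr2 => h.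
  rewrite mulr1; transitivity (16 * u * (u * s%:R)); last by ring.
  by rewrite h; field.
rewrite (card_fibres (label 0)) natr_sum; apply: ler_sum => l _.
rewrite -(_ : #|[set: 'I_n]|%:R = n%:R :> R); last by rewrite cardsT card_ord.
apply: (card_le_fibres (h := fun v => part v)) => Z.
have [->|[v]] := set_0Vmem [set v in [set v in ~: heavy 0 | label 0 v == l] | part v == Z].
  by rewrite cards0 mulr_ge0 ?sqr_ge0.
rewrite !inE => /andP[/andP[hv /eqP lv] /eqP pv].
rewrite -ltNge /threshold expr0 mulr1 in hv.
have -> : [set v in [set: 'I_n] | part v == Z] = part v.
  by apply/setP => w; rewrite !inE (mem_pblock_eq hP) pv.
apply: le_trans (ltW hv); rewrite ler_nat; apply: subset_leq_card.
apply/subsetP => w; rewrite mem_cell !inE => /andP[/andP[_ /eqP ->] /eqP ->].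
by rewrite lv pv !eqxx.
Qed.

(** In a heavy cell that is not split, some codeword class misses less than a share [u ^+ 2]. This
    class lies in one cell of the next level, which is therefore heavy, so only the missed vertices
    can turn light. *)
Lemma card_heavy_drop r :
  #|heavy r :\: split r :\: heavy r.+1|%:R <= u ^+ 2 * n%:R.
Proof.
rewrite -(_ : #|[set: 'I_n]|%:R = n%:R :> R); last by rewrite cardsT card_ord.
apply: (card_le_fibres (h := fun v => (part v, label r v))) => Z.
have [->|[v]] := set_0Vmem [set v in heavy r :\: split r :\: heavy r.+1 | (part v, label r v) == Z].
  by rewrite cards0 mulr_ge0 ?sqr_ge0.
rewrite !inE => /andP[/and3P[_ hs hv] /eqP <-].
rewrite -cellE; move: hs; rewrite hv /= negb_forall_in => /exists_inP[q qv].
rewrite -ltNge => /ltW hq; apply: le_trans (hq); rewrite ler_nat.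
apply: subset_leq_card; apply/subsetP => w; rewrite !inE => /andP[/and3P[hw _ _]].
rewrite xpair_eqE => hwv; rewrite (mem_pblock_eq hP) hwv /=.
apply: contraNneq hw => hwq.
have wv : w \in cell r v by rewrite mem_cell.
have pw : part w = part v by case/andP: hwv => /eqP.
have lb : label r w = label r v by case/andP: hwv => _ /eqP.
have hc : (#|cell r v :\: [set w in cell r v | codeword r (pos w) != codeword r (pos q)]|
    <= #|cell r.+1 w|)%N.
  apply: subset_leq_card; apply/subsetP => z; rewrite inE => /andP[h zv].
  rewrite inE zv /= negbK in h; move: zv; rewrite !mem_cell => /andP[/eqP -> /eqP lz].
  rewrite pw eqxx /=; move: lz lb => [z1 z2 z3] [w1 w2 w3].
  apply/eqP; rewrite /label z1 z2 w1 w2; congr (_, _, _).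
  apply: level_residueS; first by apply: val_inj; rewrite /= z3 w3.
  by apply: codeword_inj; rewrite (eqP h) hwq.
have sub : [set w in cell r v | codeword r (pos w) != codeword r (pos q)] \subset cell r v.
  by apply/subsetP => z; rewrite inE => /andP[].
move: hc hq (hv); rewrite cardsDS // -(ler_nat R) natrB ?subset_leq_card // pw.
rewrite thresholdS.
have := u_le; have := u_gt0; rewrite expr2 => u0 ul.
move: (threshold r) #|pblock P v| #|_| #|_| => t a c d h1 h2 h3.
apply: le_trans h1; rewrite mulrAC; apply: le_trans (_ : d%:R * (1 - u * u) <= _); last by lra.
by apply: ler_wpM2r => //; nra.
Qed.

(** In a suitable block of the other side, a sixteenth of the level-r cells cut the cell of [v] into
    two substantial sides. They hold at least [N / 16 = 2 * u * n] vertices, and each heavy one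
    among them gives an irregular pair. *)
Lemma card_irregular_split r v : (r < s)%N -> v \in split r ->
  2 * u * n%:R - #|~: heavy r|%:R <=
    #|[set w | ~~ regular_pair e eps (part v) (part w)]|%:R.
Proof.
move=> rs; rewrite !inE => /andP[hv /forall_inP hs].
have u0 := u_gt0; have ul := u_le; have th := threshold_ge (ltnW rs).
pose f w := codeword r (pos w).
pose out q := #|[set w in cell r v | f w != f q]|.
have vv := mem_cell_refl r v.
have [q qv hmin] : exists2 q, q \in cell r v & forall w, w \in cell r v -> (out q <= out w)%N.
  by case: (arg_minnP out vv) => q h1 h2; exists q.
have cell0 : 0 < #|cell r v|%:R :> R by rewrite ltr0n card_cell_gt0.
have hq : u ^+ 2 * #|cell r v|%:R <= (out q)%:R := hs q qv.
have out0 : (0 < out q)%N.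
  by rewrite -(ltr_nat R); apply: lt_le_trans hq; rewrite mulr_gt0 ?exprn_gt0.
have := many_splits (f := f) (C := cell r v) _ out0 (ex_intro _ v vv) hmin.
move=> /(_ (fun _ _ => @codeword_dist r _ _)); set G := [set i | _] => hG.
(* [b] is the block that sees level [r] together with the block of [v]. *)
pose b : 'I_s := Ordinal (ltn_pmod (r + (s - blk v)) s0).
have hb : ((blk v + b) %% s = r)%N.
  rewrite /= modnDmr addnCA subnKC ?(ltnW (ltn_ord _)) //.
  by rewrite modnDr modn_small.
pose W := [set w | [&& side w == ~~ side v, blk w == b & level_residue r (pos w) \in G]].
have hW : (N <= 16 * #|W|)%N.
  rewrite -(leq_pmul2l (levels_gt0 r)) mulnCA card_block ?(ltnW rs) //.
  by rewrite mulnCA [(levels r * N)%N]mulnC leq_mul2l hG orbT.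
have size_side c i : i \in G ->
    eps * #|part v|%:R <= #|[set w in cell r v | (i \in f w) == c]|%:R.
  rewrite inE => /andP[h1 h0].
  have hc : (out q <= 16 * #|[set w in cell r v | (i \in f w) == c]|)%N by case: c.
  move: hc; rewrite -(ler_nat R) natrM => hc.
  exact: (threshold_share (ler0n _ _) (ltW u0) heps th hv hq hc).
suff hirr : W :\: ~: heavy r \subset [set w | ~~ regular_pair e eps (part v) (part w)].
  have := subset_leq_card hirr; rewrite cardsD -(ler_nat R); apply: le_trans.
  have h1 : (#|W :&: ~: heavy r| <= #|~: heavy r|)%N by rewrite subset_leq_card ?subsetIr.
  have h2 : (#|W :&: ~: heavy r| <= #|W|)%N by rewrite subset_leq_card ?subsetIl.
  rewrite natrB //; move: hW h1; rewrite -!(ler_nat R) natrM => hW h1.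
  have -> : 2 * u * n%:R = N%:R / 16.
    by rewrite card_vertices !natrM; have := us => h; rewrite -[s%:R]mul1r;
      transitivity (4 * (u * s%:R) * N%:R); [ring | rewrite h; field].
  by lra.
apply/subsetP => w; rewrite in_setD in_setC negbK => /andP[].
rewrite inE => hw; rewrite inE => /and3P[/eqP sw /eqP bw iG]; rewrite inE.
set i := level_residue r (pos w) in iG.
pose j := level_residue r (pos v).
(* The bit at coordinate [j] cuts [cell r w] in two; from its larger side, an edge depends only on
   the bit at [i] of the other endpoint. *)
have [c hc] : exists c, (#|cell r w| <= 2 * #|[set w' in cell r w | (j \in f w') == c]|)%N.
  exact: larger_side.
have vals x y c' : x \in [set w in cell r v | (i \in f w) == c'] ->
    y \in [set w' in cell r w | (j \in f w') == c] -> e x y = (c' == c).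
  rewrite inE mem_cell => /andP[/andP[_ /eqP[s1 b1 l1]] /eqP e1].
  rewrite inE mem_cell => /andP[/andP[_ /eqP[s2 b2 l2]] /eqP e2].
  rewrite he; last by rewrite s1 s2 sw; case: ((g v).1).
  rewrite /tower_pattern b1 b2 bw hb -/(f x) -/(f y).
  have -> : level_residue r (pos y) = i by apply: val_inj.
  have -> : level_residue r (pos x) = j by apply: val_inj.
  by rewrite e1 e2.
have pos_of (A B : {set 'I_n}) : (0 < #|B|)%N -> eps * #|B|%:R <= #|A|%:R -> (0 < #|A|)%N.
  by move=> B0; rewrite -(ltr_nat R); apply: lt_le_trans; rewrite mulr_gt0 ?ltr0n.
have part0 x : (0 < #|part x|)%N by apply/card_gt0P; exists x; rewrite (mem_pblock_eq hP).
have sizeY : eps * #|part w|%:R <= #|[set w' in cell r w | (j \in f w') == c]|%:R.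
  move: hc; rewrite -(ler_nat R) natrM => hc; have ul1 : u <= 1 by lra.
  exact: (threshold_half (ler0n _ _) (ltW u0) ul1 heps th hw hc).
have subcell r' x (Q : pred 'I_n) : [set y in cell r' x | Q y] \subset part x.
  by apply/subsetP => y; rewrite !inE => /andP[/andP[]].
apply: (@irregular_of_const _ _ _ _ _ _ [set w in cell r v | (i \in f w) == c]
  [set w in cell r v | (i \in f w) == ~~ c]
  [set w' in cell r w | (j \in f w') == c]); try exact: subcell.
- apply: le_lt_trans heps _; rewrite -[u]/u.
  have : u ^+ 2 <= 1 by rewrite expr2; nra.
  have : 0 <= u ^+ 2 by apply: sqr_ge0.
  by rewrite (_ : u ^+ 4 = u ^+ 2 * u ^+ 2) -?exprD //; nra.
- exact: pos_of (part0 v) (size_side _ _ iG).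
- exact: pos_of (part0 v) (size_side _ _ iG).
- exact: pos_of (part0 w) sizeY.
- exact: (size_side _ _ iG).
- exact: (size_side _ _ iG).
- exact: sizeY.
- by move=> x y hx hy; rewrite (vals _ _ _ hx hy) eqxx.
- by move=> x y hx hy; rewrite (vals _ _ _ hx hy); case: (c).
Qed.

Lemma n_gt0 : (0 < n)%N.
Proof. by rewrite card_vertices !muln_gt0 s0 N0. Qed.

(** Each split vertex is the first entry of at least [u * n] irregular pairs of vertices, of which
    there are at most [eps * n ^ 2]. *)
Lemma card_split r : (r < s)%N -> #|~: heavy r|%:R <= u * n%:R ->
  #|split r|%:R <= u ^+ 3 / 32 * n%:R.
Proof.
move=> rs hr; have u0 := u_gt0; have n0 : 0 < n%:R :> R by rewrite ltr0n n_gt0.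
have hirr v : v \in split r ->
    u * n%:R <= #|[set w | ~~ regular_pair e eps (part v) (part w)]|%:R.
  by move=> hv; have := card_irregular_split rs hv; lra.
have := card_irregular_pairs hP hreg; rewrite (card_fibres fst) natr_sum => hle.
have : #|split r|%:R * (u * n%:R) <= eps * (n ^ 2)%:R.
  apply: le_trans hle; rewrite (bigID (mem (split r))) /= mulr_natl -sumr_const.
  apply: le_trans (_ : _ <= \sum_(v in split r)
    #|[set p in [set p : 'I_n * 'I_n | ~~ regular_pair e eps (part p.1) (part p.2)] | p.1 == v]|%:R) _.
    apply: ler_sum => v /hirr hv; apply: le_trans hv _; rewrite ler_nat.
    rewrite -(card_imset _ (_ : injective (fun w => (v, w)))); last by move=> ? ? [].
    apply: subset_leq_card; apply/subsetP => p /imsetP[w].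
    by rewrite inE => h ->; rewrite !inE /= h eqxx.
  by rewrite lerDl sumr_ge0.
rewrite natrX expr2 !mulrA ler_pM2r // => h1.
have h2 : #|split r|%:R * u <= u ^+ 4 / 32 * n%:R.
  by apply: le_trans h1 _; rewrite ler_pM2r.
rewrite -(ler_pM2r u0); apply: le_trans h2 _.
by rewrite [u ^+ 4]exprS; lra.
Qed.

(** A vertex that turns light at level r + 1 is split or counted by [card_heavy_drop]. Since
    [r * u <= 1/64], the accumulated loss stays below [u * n], as [card_split] requires at the next
    step. *)
Lemma card_light r : (r <= s)%N ->
  #|~: heavy r|%:R <= (u / 4 + r%:R * (u ^+ 2 + u ^+ 3 / 32)) * n%:R.
Proof.
have u0 := u_gt0; have ul := u_le; have hus := us.
have n0 : 0 < n%:R :> R by rewrite ltr0n n_gt0.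
elim: r => [_|r IH rs]; first by rewrite mul0r addr0 card_light0.
have {}IH := IH (ltnW rs).
have hu : #|~: heavy r|%:R <= u * n%:R.
  apply: le_trans IH _; rewrite ler_pM2r //.
  have h : r%:R * u <= 64^-1 by rewrite -hus mulrC ler_pM2l // ler_nat ltnW.
  have -> : r%:R * (u ^+ 2 + u ^+ 3 / 32) = (r%:R * u) * (u + u ^+ 2 / 32).
    by rewrite [u ^+ 3]exprS expr2; ring.
  apply: le_trans (_ : _ <= u / 4 + 64^-1 * (u + u ^+ 2 / 32)) _.
    rewrite lerD2l ler_wpM2r // addr_ge0 ?(ltW u0) // divr_ge0 ?sqr_ge0 //.
  by rewrite expr2; nra.
have hs := card_split rs hu; have hd := card_heavy_drop r.
have : #|~: heavy r.+1|%:R <= #|~: heavy r|%:R + #|split r|%:R +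
    #|heavy r :\: split r :\: heavy r.+1|%:R :> R.
  rewrite -!natrD ler_nat.
  apply: leq_trans (leq_add (leq_card_setU _ _) (leqnn _)).
  apply: leq_trans (leq_card_setU _ _); apply: subset_leq_card; apply/subsetP => v.
  rewrite !(in_setU, in_setD, in_setC).
  by case: (v \in heavy r.+1); case: (v \in heavy r); case: (v \in split r).
by rewrite -[r.+1%:R]natr1 => h; lra.
Qed.

(** At least half of the vertices are heavy at level [s]. A part containing one of them has at most
    [N / (levels s * threshold s)] vertices, because a label class of level [s] has only
    [N / levels s]. *)
Lemma card_parts_ge : (half_tower s <= #|P| * (1024 * s))%N.
Proof.
have u0 := u_gt0; have ul := u_le; have hus := us.
have n0 : 0 < n%:R :> R by rewrite ltr0n n_gt0.
have th := threshold_ge (leqnn s).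
have tpos : 0 < threshold s by apply: lt_le_trans th; rewrite divr_gt0 ?exprn_gt0.
have hl : #|~: heavy s|%:R <= n%:R / 2 :> R.
  have h := card_light (leqnn s); apply: le_trans h _; rewrite mulrC ler_pM2l //.
  have -> : s%:R * (u ^+ 2 + u ^+ 3 / 32) = (u * s%:R) * (u + u ^+ 2 / 32).
    by rewrite [u ^+ 3]exprS expr2; ring.
  by rewrite hus expr2; nra.
have hh : n%:R / 2 <= #|heavy s|%:R :> R.
  by have := cardsC (heavy s); rewrite card_ord => /(congr1 (fun k => k%:R : R));
    rewrite natrD; lra.
have Lpos : 0 < (levels s)%:R :> R by rewrite ltr0n levels_gt0.
have hpart v : v \in heavy s -> (levels s)%:R * (threshold s * #|part v|%:R) <= N%:R.
  rewrite inE => hv; rewrite -(card_label_class v) natrM ler_pM2l //.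
  apply: le_trans hv _; rewrite ler_nat; apply: subset_leq_card.
  by apply/subsetP => w; rewrite mem_cell inE => /andP[].
have hsum : (levels s)%:R * threshold s * #|heavy s|%:R <= #|P|%:R * N%:R.
  have -> : #|heavy s|%:R = \sum_(Z in P) #|[set v in heavy s | part v == Z]|%:R :> R.
    rewrite (card_fibres (fun v => part v)) natr_sum (bigID (mem P)) /= [X in _ + X]big1 ?addr0 //.
    move=> Z ZP; apply/eqP; rewrite pnatr_eq0 cards_eq0; apply/eqP/setP => v.
    rewrite !inE; apply/negbTE; rewrite negb_and; apply/orP; right.
    by apply: contraNneq ZP => <-; apply: pblock_in.
  rewrite mulr_sumr [leRHS]mulr_natl -sumr_const; apply: ler_sum => Z _.
  have [->|[v]] := set_0Vmem [set v in heavy s | part v == Z].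
    by rewrite cards0 mulr0.
  rewrite inE => /andP[hv /eqP pv]; rewrite -mulrA; apply: le_trans (hpart _ hv).
  rewrite !ler_pM2l // ler_nat; apply: subset_leq_card; apply/subsetP => w.
  by rewrite (mem_pblock_eq hP) inE pv => /andP[].
have N1 : 0 < N%:R :> R by rewrite ltr0n.
have nE : n%:R = 2 * s%:R * N%:R :> R by rewrite card_vertices !natrM.
have h1 : (levels s)%:R * (u ^+ 2 / 2) * (s%:R * N%:R) <= #|P|%:R * N%:R.
  apply: le_trans hsum; apply: ler_pM; rewrite ?mulr_ge0 ?divr_ge0 ?sqr_ge0 ?invr_ge0 ?(ltW Lpos) //.
    by rewrite ler_pM2l.
  by apply: le_trans hh; rewrite nE; lra.
have {h1} h1 : (levels s)%:R * (u ^+ 2 / 2) * s%:R <= #|P|%:R.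
  by rewrite -(ler_pM2r N1) -[_ * s%:R * _]mulrA.
have {h1} h1 : (levels s)%:R * u <= 128 * #|P|%:R.
  have -> : (levels s)%:R * u = 128 * ((levels s)%:R * (u / 2) * 64^-1) by field.
  by rewrite ler_pM2l // -hus; apply: le_trans h1; rewrite expr2; lra.
have spos : 0 < s%:R :> R by rewrite ltr0n.
have {h1} : (levels s)%:R * 64^-1 <= 128 * #|P|%:R * s%:R :> R.
  by rewrite -hus mulrA ler_pM2r.
rewrite -(ler_nat R) !natrM; lra.
Qed.
End LowerBound.

(** * Realising the tower pattern in a class of infinite VC-dimension *)

Lemma vc_witness_finType n (e : rel 'I_n) (I : finType) : vc_witness e #|I| ->
  exists (a : I -> 'I_n) (b : {set I} -> 'I_n), forall i S, e (a i) (b S) = (i \in S).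
Proof.
move=> [a [b hab]]; exists (fun i => a (enum_rank i)), (fun S : {set I} => b [set enum_rank i | i in S]).
by move=> i S; rewrite hab mem_imset //; apply: enum_rank_inj.
Qed.

(* The column of [y] is shattered together with a marker for [y] and a free set
   [T], which is used to avoid the at most [#|A|] vertices chosen for the rows. *)
Lemma bipartite_pattern (H : gclass) (A : finType) (f : A -> A -> bool) :
  hereditary H -> infinite_VC H ->
  exists n (e : rel 'I_n) (g : 'I_n -> bool * A),
    [/\ H n e, bijective g &
        forall v w, (g v).1 = false -> (g w).1 = true -> e v w = f (g v).2 (g w).2].
Proof.
move=> [_ hered] hVC; pose I : finType := (A + (A + A))%type.
have [m [e0 [He0 /vc_witness_finType[a [b hab]]]]] := hVC #|I|.
have a_inj : injective a.
  by move=> i j hij; apply/esym/set1P; rewrite -hab -hij hab set11.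
have b_inj : injective b by move=> S T h; apply/setP => i; rewrite -!hab h.
pose S y (T : {set A}) : {set I} :=
  [set i | match i with inl x => f x y | inr (inl z) => z \in T | inr (inr z) => z == y end].
have S_inj y T y' T' : S y T = S y' T' -> y = y' /\ T = T'.
  move=> /setP h; split; last by apply/setP => z; have := h (inr (inl z)); rewrite !inE.
  by have := h (inr (inr y)); rewrite !inE eqxx => /esym/eqP.
have avoid y : exists T, [forall x : A, b (S y T) != a (inl x)].
  apply/existsP; apply: contraT => /existsPn /= hcov.
  have sub : [set b (S y T) | T in [set: {set A}]] \subset [set a (inl x) | x in [set: A]].
    apply/subsetP => v /imsetP[T _ ->]; have := hcov T; rewrite negb_forall => /existsP[x].
    by rewrite negbK => /eqP ->; apply: imset_f.
  have := subset_leq_card sub; rewrite !card_imset; last first.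
  - by move=> x x' /a_inj[].
  - by move=> T T' /b_inj h; case: (S_inj _ _ _ _ h).
  by rewrite -powersetT card_powerset cardsT leqNgt ltn_expl.
have [T hT] := choice avoid.
pose psi (p : bool * A) := if p.1 then b (S p.2 (T p.2)) else a (inl p.2).
have psi_inj : injective psi.
  move=> [[] x] [[] y]; rewrite /psi /=.
  - by move=> /b_inj h; case: (S_inj _ _ _ _ h) => ->.
  - by move=> h; have /forallP/(_ y) := hT x; rewrite h eqxx.
  - by move=> h; have /forallP/(_ x) := hT y; rewrite h eqxx.
  - by move=> /a_inj[->].
exists #|{: bool * A}|, (fun v w => e0 (psi (enum_val v)) (psi (enum_val w))), enum_val.
split.
- apply: (hered _ _ _ _ He0); exists (fun v => psi (enum_val v)); split=> //.
  by move=> v w /psi_inj/enum_val_inj.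
- exact: enum_val_bij.
- move=> v w; case: (enum_val v) => -[] x //= _; case: (enum_val w) => -[] y //= _.
  by rewrite /psi /= hab inE.
Qed.

Lemma exists_codes : exists code : forall r, nat -> {set 'I_(levels r)},
  forall r p q, (p < q < 2 ^ half_tower r)%N ->
    (2 * half_tower r <= #|symdiff (code r p) (code r q)|)%N.
Proof.
exists (fun r => projT1 (cid (exists_code (half_tower_gt0 r)))) => r.
by case: (cid _).
Qed.

Lemma tower_patternC s a b x y (code : forall r, nat -> {set 'I_(levels r)}) :
  tower_pattern code s a b x y = tower_pattern code s b a y x.
Proof. by rewrite /tower_pattern addnC eq_sym. Qed.

Lemma M_bound_ge (R : realType) (H : gclass) (eps : R) (s M : nat) :
  hereditary H -> infinite_VC H -> (0 < s)%N -> 0 < eps ->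
  eps <= (64 * s)%:R^-1 ^+ 4 / 32 -> M_bound H eps M ->
  (half_tower s <= M * (1024 * s))%N.
Proof.
move=> hH hVC s0 eps0 heps [N0 hM].
have [code hcode] := exists_codes.
(* A multiple of [levels s], so that the cells of one level have equal size, and large enough to
   pass the threshold [N0]. *)
pose N := (levels s * N0.+1)%N.
have Npos : (0 < N)%N by rewrite muln_gt0 levels_gt0.
pose f (p q : 'I_s * 'I_N) := tower_pattern code s p.1 q.1 p.2 q.2.
have [n [e [g [He gbij hg]]]] := bipartite_pattern f hH hVC.
have [simple _] := hH; have [esym _] := simple _ _ He.
have nE := card_vertices gbij.
have hn : (N0 <= n)%N.
  rewrite nE; apply: (@leq_trans N); last by rewrite leq_pmull // muln_gt0.
  by apply: leq_trans (leqnSn _) _; rewrite leq_pmull ?levels_gt0.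
have [P [hP hc]] := hM n e hn He.
have hpart : finset.partition P [set: 'I_n] by case/andP: hP.
apply: (@leq_trans (#|P| * (1024 * s))%N); last by rewrite leq_mul2r hc orbT.
apply: (card_parts_ge hcode gbij s0 Npos _ _ hpart hP heps eps0).
  exact: dvdn_mulr.
move=> v w; case hv : (g v).1; case hw : (g w).1 => // _; last exact: hg.
by rewrite esym hg // tower_patternC.
Qed.

(** * Energy increment *)

Section Averaging.
Variables (R : realType) (Om S : finType) (phi : Om -> R).

(** The conditional expectation of [phi] given the partition into fibres of [F], for the counting
    measure. *)
Definition average (S : finType) (F : Om -> S) (w : Om) : R :=
  (\sum_(w' | F w' == F w) phi w') / #|[set w' | F w' == F w]|%:R.

Definition energy (S : finType) (F : Om -> S) : R := \sum_w average F w ^+ 2.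

Lemma average_eq (F : Om -> S) w w' : F w = F w' -> average F w = average F w'.
Proof. by rewrite /average => ->. Qed.

(** The defining property of conditional expectation, tested against functions constant on the
    fibres of [F]. *)
Lemma sum_average_mul (F : Om -> S) (u : Om -> R) :
  (forall w w', F w = F w' -> u w = u w') ->
  \sum_w average F w * u w = \sum_w phi w * u w.
Proof.
move=> hu; rewrite (partition_big F xpredT) //= [RHS](partition_big F xpredT) //=.
apply: eq_bigr => s _; have [w0 /eqP hw0|none] := pickP (fun w => F w == s); last first.
  by rewrite !big_pred0.
rewrite (eq_bigr (fun=> average F w0 * u w0)); last first.
  by move=> w /eqP hw; rewrite (average_eq (w' := w0)) ?(hu w w0) ?hw ?hw0.
rewrite [RHS](eq_bigr (fun w => phi w * u w0)); last first.
  by move=> w /eqP hw; rewrite (hu w w0) ?hw ?hw0.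
rewrite -!mulr_suml sumr_const -[_ *+ _]mulr_natl; congr (_ * _).
rewrite /average hw0 cardsE mulrAC divff ?mul1r // pnatr_eq0 -lt0n; apply/card_gt0P.
by exists w0; apply/eqP.
Qed.
End Averaging.

(** Pythagoras: the average over [F] is the orthogonal projection of the average over the finer
    [G]. *)
Lemma energy_refine (R : realType) (Om S S' : finType) (phi : Om -> R)
    (F : Om -> S) (G : Om -> S') :
  (forall w w', G w = G w' -> F w = F w') ->
  energy phi G = energy phi F + \sum_w (average phi G w - average phi F w) ^+ 2.
Proof.
move=> hGF; have h1 : \sum_w average phi G w * average phi F w = energy phi F.
  rewrite sum_average_mul; last by move=> w w' /hGF; apply: average_eq.
  rewrite -(sum_average_mul phi (F := F)); last exact: average_eq.
  by apply: eq_bigr => w _; rewrite expr2.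
rewrite (eq_bigr (fun w => average phi G w ^+ 2 + (average phi F w ^+ 2 -
   2 * (average phi G w * average phi F w)))); last by move=> w _; ring.
rewrite !big_split /= sumrN -mulr_sumr h1 -/(energy phi G) -/(energy phi F); ring.
Qed.

Lemma energy_le (R : realType) (Om S : finType) (phi : Om -> R) (F : Om -> S) :
  (forall w, 0 <= phi w <= 1) -> energy phi F <= #|Om|%:R.
Proof.
move=> hphi; rewrite -sumr_const; apply: ler_sum => w _.
have h0 : 0 <= average phi F w.
  by rewrite divr_ge0 ?sumr_ge0 // => w' _; case/andP: (hphi w').
apply: exprn_ile1 => //; rewrite ler_pdivrMr ?mul1r; last first.
  by rewrite ltr0n; apply/card_gt0P; exists w; rewrite inE.
rewrite cardsE -sumr_const; apply: ler_sum => w' _; by case/andP: (hphi w').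
Qed.

Section EnergyIncrement.
Variables (R : realType) (n : nat) (e : rel 'I_n).

Let edge (p : 'I_n * 'I_n) : R := (e p.1 p.2)%:R.
Definition square (T : Type) (f : 'I_n -> T) (p : 'I_n * 'I_n) := (f p.1, f p.2).
Definition fibre (T : eqType) (f : 'I_n -> T) (i : T) := [set v | f v == i].

Lemma sum_edge (X Y : {set 'I_n}) :
  \sum_(p in finset.setX X Y) edge p = density R e X Y * #|finset.setX X Y|%:R.
Proof.
rewrite /density cardsX.
have -> : \sum_(p in finset.setX X Y) edge p = #|[set p in finset.setX X Y | e p.1 p.2]|%:R.
  rewrite -sum1dep_card natr_sum big_mkcondr; apply: eq_bigr => p _.
  by rewrite /edge; case: (e _ _).
have [h|h] := eqVneq (#|X| * #|Y|)%N 0%N; last by rewrite divfK // pnatr_eq0.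
rewrite h mulr0 -(mulr0n 1); congr (_ *+ _); apply/eqP; rewrite -leqn0 -h -cardsX.
by apply: subset_leq_card; apply/subsetP => p; rewrite inE => /andP[].
Qed.

Lemma average_density (T : finType) (f : 'I_n -> T) p :
  average edge (square f) p = density R e (fibre f (f p.1)) (fibre f (f p.2)).
Proof.
set X := fibre f (f p.1); set Y := fibre f (f p.2).
have hXY : [set p' | square f p' == square f p] = finset.setX X Y.
  by apply/setP => p'; rewrite !inE xpair_eqE.
have -> : average edge (square f) p =
    (\sum_(q in finset.setX X Y) edge q) / #|finset.setX X Y|%:R.
  by rewrite /average hXY; congr (_ / _); apply: eq_bigl => q; rewrite !inE xpair_eqE.
rewrite sum_edge mulfK // pnatr_eq0 -lt0n; apply/card_gt0P.
by exists p; rewrite !inE !eqxx.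
Qed.

Variables (T : finType) (f : 'I_n -> T) (eps : R).
Hypothesis eps0 : 0 < eps.

(** Besides its old label, a vertex records the cells with which its own forms a pair whose witness
    contains it, once as first and once as second member of the pair. *)
Definition refined_label := (T * ({set T} * {set T}))%type.

Lemma irregular_witness (X Y : {set 'I_n}) : ~~ regular_pair e eps X Y ->
  exists XY : {set 'I_n} * {set 'I_n}, [/\ XY.1 \subset X, XY.2 \subset Y,
    eps * #|X|%:R <= #|XY.1|%:R, eps * #|Y|%:R <= #|XY.2|%:R &
    eps < `|density R e XY.1 XY.2 - density R e X Y| ].
Proof.
rewrite negb_forall => /existsP[X']; rewrite negb_forall => /existsP[Y'].
rewrite negb_imply -ltNge => /andP[/and4P[h1 h2 h3 h4] h5].
by exists (X', Y'); rewrite distrC.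
Qed.

(* Adding, for every irregular pair of cells, a witness of irregularity to the
   partition raises the energy on the witness by [eps ^+ 2] times its size. *)
Lemma energy_increment : exists g : 'I_n -> refined_label,
  energy edge (square f) + eps ^+ 4 *
    #|[set p : 'I_n * 'I_n | ~~ regular_pair e eps (fibre f (f p.1)) (fibre f (f p.2))]|%:R
  <= energy edge (square g).
Proof.
pose irr i j := ~~ regular_pair e eps (fibre f i) (fibre f j).
have hW (ij : T * T) : exists XY : {set 'I_n} * {set 'I_n}, irr ij.1 ij.2 ->
   [/\ XY.1 \subset fibre f ij.1, XY.2 \subset fibre f ij.2,
    eps * #|fibre f ij.1|%:R <= #|XY.1|%:R, eps * #|fibre f ij.2|%:R <= #|XY.2|%:R &
    eps < `|density R e XY.1 XY.2 - density R e (fibre f ij.1) (fibre f ij.2)| ].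
  case: (boolP (irr ij.1 ij.2)) => [/irregular_witness[XY h]|_]; first by exists XY.
  by exists (finset.set0, finset.set0).
have {hW} [W hW] := choice hW.
pose g v : refined_label :=
  (f v, ([set j | v \in (W (f v, j)).1], [set i | v \in (W (i, f v)).2])).
exists g; have hgf p q : square g p = square g q -> square f p = square f q.
  by move=> [h1 _ _ h2 _ _]; rewrite /square h1 h2.
rewrite (energy_refine edge hgf) lerD2l.
pose D p : R := average edge (square g) p - average edge (square f) p.
rewrite -[leRHS]/(\sum_p D p ^+ 2).
rewrite (card_fibres (square f)) natr_sum mulr_sumr (partition_big (square f) xpredT) //=.
apply: ler_sum => ij _.
have [hirr|hreg] := boolP (irr ij.1 ij.2); last first.
  rewrite (_ : [set _ in _ | _] = finset.set0) ?cards0 ?mulr0 ?sumr_ge0 //.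
    by move=> p _; apply: sqr_ge0.
  apply/setP => p; rewrite !inE; apply/negbTE; apply: contra hreg => /andP[h /eqP <-].
  exact: h.
have [s1 s2 c1 c2 hd] := hW ij hirr.
set X := (W ij).1 in s1 c1 hd; set Y := (W ij).2 in s2 c2 hd.
set X0 := fibre f ij.1 in s1 c1 hd; set Y0 := fibre f ij.2 in s2 c2 hd.
set c := density R e X Y - density R e X0 Y0 in hd.
have inXY p : p \in finset.setX X Y -> square f p = ij.
  rewrite inE => /andP[/(subsetP s1) + /(subsetP s2)].
  by rewrite !inE /square => /eqP -> /eqP ->; case: (ij).
have measurable p q : square g p = square g q ->
    (p \in finset.setX X Y) = (q \in finset.setX X Y).
  move=> hpq; have hf := hgf _ _ hpq.
  have [hp|hp] := eqVneq (square f p) ij; last first.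
    have hq : square f q != ij by rewrite -hf.
    by apply/idP/idP => /inXY h; [rewrite h eqxx in hp | rewrite h eqxx in hq].
  have hq : square f q = ij by rewrite -hf.
  case: hpq => _ /setP/(_ ij.2) h1 _ _ _ /setP/(_ ij.1) h2.
  have eij (r : 'I_n * 'I_n) : square f r = ij -> (f r.1 = ij.1) * (f r.2 = ij.2).
    by move=> <-.
  move: h1 h2; rewrite !inE !(eij _ hp) !(eij _ hq).
  by rewrite -!surjective_pairing -/X -/Y => -> ->.
(* The witness rectangle is a union of cells of [square g], so averaging over these keeps its number
   of edges, while the average over the old cells is the constant density of [X0] and [Y0]. *)
have sumD : \sum_(p in finset.setX X Y) D p = c * #|finset.setX X Y|%:R.
  rewrite /D sumrB mulrBl -sum_edge; congr (_ - _).
    rewrite big_mkcond [RHS]big_mkcond /=.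
    have := sum_average_mul edge (F := square g) (u := fun p => (p \in finset.setX X Y)%:R).
    move=> /(_ (fun p q h => congr1 (fun b : bool => b%:R) (measurable p q h))) h.
    rewrite (eq_bigr (fun p => average edge (square g) p * (p \in finset.setX X Y)%:R)).
      rewrite h; apply: eq_bigr => p _.
      by case: (p \in _); rewrite ?mulr1 ?mulr0.
    by move=> p _; case: (p \in _); rewrite ?mulr1 ?mulr0.
  rewrite [RHS]mulr_natr -sumr_const.
  apply: eq_bigr => p /inXY hp; rewrite average_density /X0 /Y0.
  by case: hp => <-.
apply: (@le_trans _ _ (\sum_(p in finset.setX X Y) D p ^+ 2)); last first.
  rewrite [leRHS](bigID (mem (finset.setX X Y))) /= [X in _ <= X + _](eq_bigl (mem (finset.setX X Y))).
    by rewrite lerDl sumr_ge0 // => p _; apply: sqr_ge0.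
  by move=> p /=; apply/andP/idP => [[]//|h]; rewrite (inXY _ h).
(* Cauchy-Schwarz, in the form that the squares of [D - c] have a nonnegative sum. *)
have hsq : c ^+ 2 * #|finset.setX X Y|%:R <= \sum_(p in finset.setX X Y) D p ^+ 2.
  have : 0 <= \sum_(p in finset.setX X Y) (D p - c) ^+ 2.
    by apply: sumr_ge0 => p _; apply: sqr_ge0.
  rewrite (eq_bigr (fun p => D p ^+ 2 + (c ^+ 2 - 2 * c * D p))); last by move=> p _; ring.
  rewrite !big_split /= sumrN -[X in _ - X]mulr_sumr sumD sumr_const -[_ *+ #|_|]mulr_natr.
  by rewrite expr2 => h; lra.
apply: le_trans hsq.
have e2c : eps ^+ 2 <= c ^+ 2.
  rewrite -[c ^+ 2]real_normK ?num_real //.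
  by rewrite ler_sqr ?nnegrE ?normr_ge0 ?(ltW eps0) ?(ltW hd).
apply: (@le_trans _ _ (eps ^+ 2 * (eps ^+ 2 * #|finset.setX X0 Y0|%:R))).
  rewrite (_ : 4 = 2 + 2)%N // exprD -mulrA ler_pM2l ?exprn_gt0 // ler_pM2l ?exprn_gt0 //.
  rewrite ler_nat; apply: subset_leq_card; apply/subsetP => p; rewrite !inE.
  by case/andP => _ /eqP <-; rewrite !eqxx.
rewrite !cardsX !natrM; apply: ler_pM; rewrite ?sqr_ge0 //.
  by rewrite mulr_ge0 ?sqr_ge0 ?mulr_ge0.
rewrite expr2 mulrACA; apply: ler_pM => //; by rewrite mulr_ge0 // ltW.
Qed.
End EnergyIncrement.

(** * The regularity lemma with a tower bound *)

Lemma energy_square_le (R : realType) n (e : rel 'I_n) (T : finType) (f : 'I_n -> T) :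
  energy (fun p => (e p.1 p.2)%:R : R) (square f) <= (n ^ 2)%:R.
Proof.
have := energy_le (phi := fun p => (e p.1 p.2)%:R : R) (square f) _.
rewrite card_prod card_ord mulnn; apply => p; by case: (e _ _); rewrite ?lexx ?ler01.
Qed.

Lemma pblock_preim n (T : finType) (f : 'I_n -> T) v :
  pblock (preim_partition f [set: 'I_n]) v = fibre f (f v).
Proof.
apply/setP => w; rewrite (mem_pblock_eq (preim_partitionP _ _)) inE.
have h := preim_partitionP f [set: 'I_n].
rewrite eq_sym eq_pblock ?(cover_partition h) ?inE //; last by case/and3P: h.
rewrite pblock_equivalence_partition ?inE // 1?eq_sym //.
by split=> [|/eqP ->]; rewrite ?eqxx.
Qed.

Lemma card_preim_partition n (T : finType) (f : 'I_n -> T) :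
  (#|preim_partition f [set: 'I_n]| <= #|[set f v | v in [set: 'I_n]]|)%N.
Proof.
have sub : preim_partition f [set: 'I_n] \subset
    [set fibre f i | i in [set f v | v in [set: 'I_n]]].
  apply/subsetP => X /imsetP[v _ ->]; apply/imsetP; exists (f v); first exact: imset_f.
  by apply/setP => w; rewrite !inE eq_sym.
exact: leq_trans (subset_leq_card sub) (leq_imset_card _ _).
Qed.

Lemma regular_preim (R : realType) n (e : rel 'I_n) (eps : R) (T : finType) (f : 'I_n -> T) :
  regular_partition e eps (preim_partition f [set: 'I_n]) =
  (#|[set p : 'I_n * 'I_n | ~~ regular_pair e eps (fibre f (f p.1)) (fibre f (f p.2))]|%:R
     <= eps * (n ^ 2)%:R).
Proof.
rewrite regular_partition_pblock ?preim_partitionP //.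
set A := [set p | regular_pair _ _ _ _]; set B := [set p | ~~ _].
have -> : B = ~: A by apply/setP => p; rewrite !inE !pblock_preim.
have := cardsC A; rewrite card_prod card_ord mulnn => /(congr1 (fun k => k%:R : R)).
rewrite natrD => <-; apply/idP/idP; lra.
Qed.

Lemma leq_tw i j : (i <= j)%N -> (tw i <= tw j)%N.
Proof.
move=> /subnKC <-; elim: (j - i)%N => [|d IH]; first by rewrite addn0.
apply: leq_trans IH _; rewrite addnS; case: (i + d)%N => [|m] //.
exact/ltnW/ltn_expl.
Qed.

(** From m labels one gets m * 4^m, which is below 2^(2^(m+1)). The strict hypothesis gives m + 1 <=
    [tw k.+1], so one refinement costs two levels of the tower. *)
Lemma card_refined_label (T : finType) k : (#|T| < tw k.+1)%N ->
  (#|{: refined_label T}| < tw k.+3)%N.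
Proof.
rewrite !card_prod -!cardsT -powersetT card_powerset cardsT.
move: #|T| => m hm.
have h1 : (3 * m + 1 <= 2 ^ m.+1)%N by elim: m {hm} => // -[|m] IH //; rewrite expnS; lia.
apply: (@leq_trans (2 ^ 2 ^ m.+1)); last first.
  by rewrite -[tw k.+3]/(2 ^ (2 ^ tw k.+1))%N !leq_exp2l.
apply: leq_trans (_ : _ <= 2 ^ (3 * m + 1))%N _; last by rewrite leq_exp2l.
have : (m <= 2 ^ m)%N by apply/ltnW/ltn_expl.
have -> : (2 ^ (3 * m + 1) = 2 * (2 ^ m * (2 ^ m * 2 ^ m)))%N.
  by rewrite addn1 expnS -!expnD; congr (2 * 2 ^ _)%N; lia.
have : (0 < 2 ^ m)%N by rewrite expn_gt0.
move: (2 ^ m)%N => a a0 ha.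
have : (m * (a * a) <= a * (a * a))%N by rewrite leq_mul2r ha orbT.
have : (0 < a * (a * a))%N by rewrite !muln_gt0 a0.
lia.
Qed.

(** A partition that is not regular has more than [eps * n ^ 2] irregular pairs of vertices, each
    worth [eps ^+ 4], so every round gains [eps ^+ 5 * n ^ 2]. *)
Lemma szemeredi_iterate (R : realType) n (e : rel 'I_n) (eps : R) (j : nat) : 0 < eps ->
  exists T : finType, exists f : 'I_n -> T, (#|T| < tw (2 * j).+2)%N /\
    (regular_partition e eps (preim_partition f [set: 'I_n]) \/
     eps ^+ 5 * (n ^ 2)%:R *+ j <= energy (fun p => (e p.1 p.2)%:R : R) (square f)).
Proof.
move=> eps0; elim: j => [|j [T [f [hT [hreg|hen]]]]].
- exists unit, (fun=> tt); rewrite card_unit; split=> //; right.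
  by rewrite mulr0n; apply: sumr_ge0 => p _; apply: sqr_ge0.
- exists T, f; split; last by left.
  by apply: leq_trans hT _; apply: leq_tw; lia.
- have [hreg|hreg] := boolP (regular_partition e eps (preim_partition f [set: 'I_n])).
    exists T, f; split; last by left.
    by apply: leq_trans hT _; apply: leq_tw; lia.
  have [g hg] := energy_increment e f eps0.
  exists (refined_label T), g; split; first by rewrite mulnS; apply: card_refined_label.
  right; apply: le_trans hg; rewrite mulrSr; apply: lerD => //.
  rewrite regular_preim -ltNge in hreg.
  rewrite [eps ^+ 5]exprSr -mulrA ler_pM2l ?exprn_gt0 //; exact: ltW.
Qed.

Lemma szemeredi (R : realType) n (e : rel 'I_n) (eps : R) (j : nat) :
  (0 < n)%N -> 0 < eps -> 1 < eps ^+ 5 *+ j ->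
  exists P, regular_partition e eps P /\ (#|P| <= tw (2 * j).+2)%N.
Proof.
move=> n0 eps0 hj; have [T [f [hT [hreg|hen]]]] := szemeredi_iterate e j eps0.
  exists (preim_partition f [set: 'I_n]); split=> //.
  exact: leq_trans (leq_trans (card_preim_partition f) (max_card _)) (ltnW hT).
have := le_trans hen (energy_square_le R e f).
rewrite -mulrnAl ger_pMl ?ltr0n ?expn_gt0 ?n0 // => h.
by have := lt_le_trans hj h; rewrite ltxx.
Qed.

(** * Bounded VC-dimension *)

Definition shatters (T : finType) (F : {set {set T}}) (A : {set T}) :=
  [forall B : {set T}, (B \subset A) ==> [exists S in F, S :&: A == B]].

Lemma shattersP (T : finType) (F : {set {set T}}) (A : {set T}) :
  reflect (forall B : {set T}, B \subset A -> exists2 S, S \in F & S :&: A = B) (shatters F A).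
Proof.
apply: (iffP forallP) => h B; last first.
  by apply/implyP => /h[S SF SA]; apply/exists_inP; exists S => //; apply/eqP.
by move=> hB; have /implyP/(_ hB)/exists_inP[S SF /eqP SA] := h B; exists S.
Qed.

(* Pajor's strengthening of the Sauer-Shelah lemma. *)
Lemma leq_card_shattered (T : finType) (F : {set {set T}}) :
  (#|F| <= #|[set A | shatters F A]|)%N.
Proof.
move: {2}#|F|.+1 (ltnSn #|F|) => N; elim: N F => // N IH F hN.
have [F1|F1] := leqP #|F| 1.
  have [->|[S SF]] := set_0Vmem F; first by rewrite cards0.
  apply: leq_trans F1 _; apply/card_gt0P; exists finset.set0; rewrite inE.
  apply/shattersP => B; rewrite subset0 => /eqP ->; exists S => //.
  by rewrite finset.setI0.
have [S1 [S2 [S1F S2F S12]]] := card_gt1P F1.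
have [x hx] : exists x, (x \in S1) != (x \in S2).
  apply/existsP; apply: contraNT S12 => /existsPn h; apply/eqP/setP => x.
  by have := h x; rewrite negbK => /eqP.
(* [F] is divided by membership of [x]. A set [A] shattered by both halves is counted twice in the
   induction; its second count is charged to [x |: A], which [F] shatters too. *)
pose G b := [set S in F | (x \in S) == b]; pose Sh b := [set A | shatters (G b) A].
have cardF : (#|F| = #|G true| + #|G false|)%N.
  rewrite -(cardsID [set S : {set T} | x \in S] F); congr (_ + _)%N; apply: eq_card => S.
    by rewrite !inE eqb_id.
  by rewrite !inE eqbF_neg andbC.
have G0 b : (0 < #|G b|)%N.
  apply/card_gt0P; move: hx; case h1 : (x \in S1); case h2 : (x \in S2) => // _; case: b;
    solve [by exists S1; rewrite inE S1F h1 | by exists S2; rewrite inE S2F h2].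
have IHb b : (#|G b| <= #|Sh b|)%N.
  apply: IH; move: hN; rewrite cardF ltnS; apply: leq_trans.
  by case: b; rewrite -addn1 ?leq_add2l // addnC leq_add2r.
have notin b A : A \in Sh b -> x \notin A.
  rewrite inE => /shattersP h; apply/negP => xA.
  have [S] := h _ (subxx A); rewrite inE => /andP[_ /eqP Sb] /setP/(_ x).
  rewrite inE xA Sb andbT => bT.
  have [S'] := h _ (sub0set A); rewrite inE => /andP[_ /eqP Sb'] /setP/(_ x).
  by rewrite !inE xA Sb' bT.
have subG b S : S \in G b -> S \in F by rewrite inE => /andP[].
have subSh b : Sh b \subset [set A | shatters F A].
  apply/subsetP => A; rewrite !inE => /shattersP h; apply/shattersP => B /h[S /subG SF SA].
  by exists S.
have joint A : A \in Sh true -> A \in Sh false -> shatters F (x |: A).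
  move=> h1 h0; have xA := notin _ _ h1; apply/shattersP => B hB.
  have hBA : B :\ x \subset A.
    apply/subsetP => z; rewrite !inE => /andP[zx /(subsetP hB)].
    by rewrite !inE (negbTE zx).
  have : A \in Sh (x \in B) by case: (x \in B).
  rewrite inE => /shattersP/(_ _ hBA)[S SG SA]; exists S; first exact: subG SG.
  move: SG; rewrite inE => /andP[_ /eqP Sx]; apply/setP => z; rewrite !inE.
  have [->|zx] := eqVneq z x; first by rewrite Sx andbT.
  by move/setP/(_ z): SA; rewrite !inE zx.
rewrite cardF; apply: leq_trans (leq_add (IHb true) (IHb false)) _.
rewrite -cardsUI -(card_in_imset (D := Sh true :&: Sh false) (f := fun A => x |: A)); last first.
  move=> A B; rewrite in_setI => /andP[/notin xA _]; rewrite in_setI => /andP[/notin xB _].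
  by move=> /(congr1 (fun C => C :\ x)); rewrite !setU1K.
rewrite -cardsUI [X in (_ + X)%N](_ : _ = 0%N) ?addn0; last first.
  apply/eqP; rewrite cards_eq0; apply/eqP/setP => A; rewrite [RHS]inE.
  apply/negbTE/negP; rewrite in_setI => /andP[hA /imsetP[B _ hB]].
  have xA : x \in A by rewrite hB !inE eqxx.
  by move: hA; rewrite in_setU => /orP[] /notin; rewrite xA.
apply: subset_leq_card; rewrite !subUset !subSh /=.
apply/subsetP => A /imsetP[B]; rewrite in_setI => /andP[h1 h0] ->.
by rewrite inE; apply: joint.
Qed.

(** Such a set arises from [k] successive choices, each adding an element of [Y] or, for [None],
    nothing. *)
Lemma card_small_subsets (T : finType) (Y : {set T}) (k : nat) :
  (#|[set A : {set T} | (A \subset Y) && (#|A| <= k)]| <= #|Y|.+1 ^ k)%N.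
Proof.
elim: k => [|k IH].
  rewrite expn0 -(cards1 (finset.set0 : {set T})); apply: subset_leq_card.
  by apply/subsetP => A; rewrite !inE leqn0 cards_eq0 => /andP[].
pose add (o : option T) (A : {set T}) := if o is Some x then x |: A else A.
pose O : {set option T} := None |: [set Some x | x in Y].
have cardO : (#|O| <= #|Y|.+1)%N.
  by rewrite cardsU1 -add1n leq_add ?leq_b1 ?leq_imset_card.
rewrite expnS; apply: leq_trans (leq_mul cardO IH); rewrite -cardsX.
apply: leq_trans (leq_imset_card (fun oA => add oA.1 oA.2) _); apply: subset_leq_card.
apply/subsetP => A; rewrite inE => /andP[AY Ak]; apply/imsetP.
have [A0|[x xA]] := set_0Vmem A.
  by exists (None, A); rewrite // !inE AY A0 cards0.
exists (Some x, A :\ x); last by rewrite /add /= setD1K.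
rewrite !inE /= imset_f ?(subsetP AY) // (subset_trans (subsetDl _ _)) //=.
by move: Ak; rewrite (cardsD1 x) xA.
Qed.

(** * Separated families of neighbourhoods *)

Section BoundedVC.
Variables (n : nat) (e : rel 'I_n) (k : nat).
Hypotheses (simple : simple_graph e) (noVC : ~ vc_witness e k).

Definition nbhd v := [set w | e v w].

(** A set shattered by the traces has at most [k] elements: in a larger one, [k] elements and
    vertices tracing out their subsets would be a [vc_witness]. The shattered sets bound the number
    of traces. *)
Lemma card_distinct_traces (Q Y : {set 'I_n}) :
  {in Q &, injective (fun v => nbhd v :&: Y)} -> (#|Q| <= #|Y|.+1 ^ k)%N.
Proof.
move=> Q_inj; rewrite -(card_in_imset Q_inj); set F := [set _ | _ in Q].
apply: leq_trans (leq_card_shattered F) _; apply: leq_trans (card_small_subsets Y k).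
apply: subset_leq_card; apply/subsetP => A; rewrite !inE => /shattersP hA.
apply/andP; split.
  by have [S /imsetP[v _ ->] <-] := hA _ (subxx A); rewrite -finset.setIA subIset // subsetIl orbT.
rewrite leqNgt; apply/negP => kA; apply: noVC.
pose a (i : 'I_k) : 'I_n := enum_val (widen_ord (ltnW kA) i).
have aA i : a i \in A by apply: enum_valP.
have a_inj : injective a by move=> i j /enum_val_inj/(congr1 val)/= /val_inj.
have AY : A \subset Y.
  by have [S /imsetP[v _ ->] <-] := hA _ (subxx A); rewrite -finset.setIA subIset // subsetIl orbT.
have hb (s : {set 'I_k}) : exists v, nbhd v :&: A = [set a i | i in s].
  have [|S /imsetP[v _ ->] h] := hA [set a i | i in s].
    by apply/subsetP => x /imsetP[i _ ->].
  by exists v; rewrite -h -finset.setIA (setIidPr AY).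
have [b hab] := choice hb; exists a, b => i s.
have [esym _] := simple; have /setP/(_ (a i)) := hab s.
by rewrite inE aA andbT inE esym mem_imset.
Qed.

Definition separated (h : nat) (Q : {set 'I_n}) :=
  [forall v in Q, forall w in Q, (v != w) ==> (n <= h * #|symdiff (nbhd v) (nbhd w)|)%N].

Definition unresolved (Q Y : {set 'I_n}) :=
  [set p in finset.setX Q Q | (p.1 != p.2) && (nbhd p.1 :&: Y == nbhd p.2 :&: Y)].

(** At least [n / h] vertices tell an unresolved pair apart, so by averaging some vertex resolves a
    share [1 / h] of all these pairs. *)
Lemma unresolved_step (h : nat) (Q Y : {set 'I_n}) : (0 < h)%N -> separated h Q ->
  exists Y' : {set 'I_n}, (#|Y'| <= #|Y|.+1)%N /\
    (h * #|unresolved Q Y'| <= h.-1 * #|unresolved Q Y|)%N.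
Proof.
move=> h0 sep.
have [U0|[p0 p0U]] := set_0Vmem (unresolved Q Y).
  by exists Y; rewrite U0 cards0 !muln0.
pose cut y := [set p in unresolved Q Y | y \in symdiff (nbhd p.1) (nbhd p.2)].
have [y hy] : exists y, (#|unresolved Q Y| <= h * #|cut y|)%N.
  apply/existsP; apply: contraT => /existsPn hcut.
  have n0 : (0 < n)%N by apply: leq_ltn_trans (ltn_ord p0.1).
  have up : (\sum_(y < n) (h * #|cut y| + 1) <= n * #|unresolved Q Y|)%N.
    have -> : (n * #|unresolved Q Y| = \sum_(y < n) #|unresolved Q Y|)%N.
      by rewrite sum_nat_const card_ord.
    apply: leq_sum => y _.
    by have := hcut y; rewrite -ltnNge addn1.
  have low : (n * #|unresolved Q Y| <= \sum_(y < n) h * #|cut y|)%N.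
    rewrite -big_distrr /= mulnC -sum_nat_const.
    under [X in (_ <= h * X)%N]eq_bigr => y _ do rewrite -sum1dep_card big_mkcondr.
    rewrite exchange_big big_distrr /=; apply: leq_sum => p.
    rewrite !inE => /andP[/andP[p1 p2] /andP[p12 _]].
    rewrite -big_mkcond sum1_card.
    by have /forall_inP/(_ _ p1)/forall_inP/(_ _ p2)/implyP/(_ p12) := sep.
  move: up; rewrite big_split /= sum1_card card_ord => up.
  by have := leq_trans up low; rewrite -[leqRHS]addn0 leq_add2l leqNgt n0.
exists (y |: Y); split; first by rewrite cardsU1 -add1n leq_add ?leq_b1.
have sub : cut y \subset unresolved Q Y by apply/subsetP => p; rewrite inE => /andP[].
have : (#|unresolved Q (y |: Y)| <= #|unresolved Q Y| - #|cut y|)%N.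
  rewrite -cardsDS //; apply: subset_leq_card; apply/subsetP => p.
  rewrite inE => /and3P[pQ p12 /eqP/setP hp].
  have hY : nbhd p.1 :&: Y = nbhd p.2 :&: Y.
    by apply/setP => z; have := hp z; rewrite !inE; case: (z \in Y); rewrite ?andbF ?orbT.
  have hpy := hp y; rewrite !inE eqxx /= !andbT in hpy.
  rewrite in_setD; apply/andP; split; last by rewrite inE pQ p12 hY eqxx.
  rewrite inE negb_and; apply/orP; right.
  by rewrite !inE negbK hpy.
have := subset_leq_card sub; move: #|cut y| #|unresolved Q Y| #|unresolved Q (y |: Y)| hy h0.
move=> c u u' h1 h2 h3 h4; case: h h1 h2 {sep} => // h h1 _ /=.
apply: (@leq_trans (h.+1 * (u - c))); first by rewrite leq_mul2l.
rewrite mulnBr leq_subLR; move: h1; rewrite mulSn [(h.+1 * u)%N]mulSn leq_add2r; lia.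
Qed.

Lemma unresolved_iterate (h : nat) (Q : {set 'I_n}) (j : nat) : (0 < h)%N -> separated h Q ->
  exists Y : {set 'I_n}, (#|Y| <= j)%N /\
    (h ^ j * #|unresolved Q Y| <= h.-1 ^ j * #|Q| ^ 2)%N.
Proof.
move=> h0 sep; elim: j => [|j [Y [Yj hY]]].
  exists finset.set0; rewrite cards0 !expn0 !mul1n; split=> //.
  by rewrite -mulnn -cardsX; apply: subset_leq_card; apply/subsetP => p; rewrite inE => /andP[].
have [Y' [hY1 hY2]] := unresolved_step Y h0 sep; exists Y'; split.
  exact: leq_trans hY1 _.
rewrite ![(_ ^ j.+1)%N]expnSr -!mulnA; apply: leq_trans (leq_mul (leqnn _) hY2) _.
by rewrite mulnCA [leqRHS]mulnCA leq_mul2l hY orbT.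
Qed.

Lemma double_pow_pred (h : nat) : (0 < h)%N -> (2 * h.-1 ^ h <= h ^ h)%N.
Proof.
case: h => // a _ /=.
(* Bernoulli's inequality (1 + 1/a)^m >= 1 + m/a without denominators, to be used for m = a + 1. *)
have bern m : (a ^ m * (a + m) <= a.+1 ^ m * a)%N.
  elim: m => [|m IH]; first by rewrite !expn0 addn0.
  rewrite [(a.+1 ^ _)%N]expnS -mulnA; apply: leq_trans (leq_mul (leqnn a.+1) IH).
  rewrite expnS; move: (a ^ m)%N => x; rewrite [leqRHS]mulnCA [(a * x)%N]mulnC -[leqLHS]mulnA leq_mul2l.
  apply/orP; right; nia.
case: a bern => [|a] bern; first by [].
rewrite -(leq_pmul2r (ltn0Sn a)); apply: leq_trans (bern _).
by rewrite mulnAC mulnC leq_mul2l; apply/orP; right; lia.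
Qed.

(** Every [h] steps halve the number of unresolved pairs, so [h * (2 * p).+1] steps bring it from at
    most [2 ^ (2 * p)] below one. The vertices of [Q] then have distinct traces on [Y]. *)
Lemma card_separated (h p : nat) (Q : {set 'I_n}) : (0 < h)%N -> separated h Q ->
  #|Q| = (2 ^ p)%N -> (2 ^ p <= (h * (2 * p).+1).+1 ^ k)%N.
Proof.
move=> h0 sep hQ; have [Y [hY hU]] := unresolved_iterate (h * (2 * p).+1) h0 sep.
rewrite -hQ; apply: (@leq_trans (#|Y|.+1 ^ k)); last by case: (k) => // k'; rewrite leq_exp2r.
apply: card_distinct_traces => v w vQ wQ hvw; apply/eqP; apply: contraT => vw.
have U0 : (0 < #|unresolved Q Y|)%N.
  by apply/card_gt0P; exists (v, w); rewrite !inE /= vQ wQ vw hvw eqxx.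
have hpos : (0 < h ^ (h * (2 * p).+1))%N by rewrite expn_gt0 h0.
have : (2 ^ (2 * p).+1 * h.-1 ^ (h * (2 * p).+1) <= h ^ (h * (2 * p).+1))%N.
  by rewrite !expnM -expnMn leq_exp2r // double_pow_pred.
move: hU hpos; rewrite hQ -expnM mulnC [(p * 2)%N]mulnC expnS.
move: (h ^ _)%N (h.-1 ^ _)%N (2 ^ _)%N #|_| U0 => x y z u; clear; nia.
Qed.

(** A larger separated set has a subset of size exactly [2 ^ p], which [card_separated] excludes:
    [h * (2 * p).+1 + 1] is below (8hk + 1)^2 <= 2^(16hk). *)
Lemma card_separated_lt (h : nat) (Q : {set 'I_n}) : (0 < h)%N -> (0 < k)%N -> separated h Q ->
  (#|Q| < 2 ^ (16 * (h * k) * k))%N.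
Proof.
move=> h0 k0 sep; set p := (16 * (h * k) * k)%N; rewrite ltnNge; apply/negP => hQ.
have [Q' /andP[Q'Q /eqP cQ']] : exists Q' : {set 'I_n}, (Q' \subset Q) && (#|Q'| == 2 ^ p)%N.
  have : (0 < #|[set A : {set 'I_n} | (A \subset Q) && (#|A| == 2 ^ p)%N]|)%N.
    by rewrite cards_draws bin_gt0.
  by case/card_gt0P => A; rewrite inE => hA; exists A.
have sep' : separated h Q'.
  apply/forall_inP => v /(subsetP Q'Q) vQ; apply/forall_inP => w /(subsetP Q'Q) wQ.
  by have /forall_inP/(_ _ vQ)/forall_inP/(_ _ wQ) := sep.
have := card_separated h0 sep' cQ'; rewrite leqNgt => /negP; apply.
rewrite /p expnM ltn_exp2r //.
have h1 : (8 * (h * k) < 2 ^ (8 * (h * k)))%N by apply: ltn_expl.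
have -> : (16 * (h * k) = 8 * (h * k) + 8 * (h * k))%N by lia.
rewrite expnD; apply: leq_trans (leq_mul h1 h1).
move: h0 k0 {h1 sep sep' hQ cQ' p}; case: (h) => // a _; case: (k) => // b _; nia.
Qed.
End BoundedVC.

Section ClosePartition.
Variables (n : nat) (e : rel 'I_n) (k : nat).
Hypotheses (simple : simple_graph e) (noVC : ~ vc_witness e k).

(** A separated set of maximal size is a net: [f] sends each vertex to a member at distance at most
    [n / h], and the triangle inequality gives the factor 2. *)
Lemma exists_close_partition (h : nat) : (0 < h)%N -> (0 < k)%N ->
  exists f : 'I_n -> 'I_n, (#|[set f v | v in [set: 'I_n]]| < 2 ^ (16 * (h * k) * k))%N /\
    forall v w, f v = f w -> (h * #|symdiff (nbhd e v) (nbhd e w)| <= 2 * n)%N.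
Proof.
move=> h0 k0.
have sep0 : separated e h finset.set0 by apply/forall_inP => v; rewrite inE.
have [Q sepQ maxQ] : exists2 Q, separated e h Q &
    forall Q', separated e h Q' -> (#|Q'| <= #|Q|)%N.
  by case: (arg_maxnP (fun Q : {set 'I_n} => #|Q|) sep0) => Q h1 h2; exists Q.
have close v : exists q, (q \in Q) && (h * #|symdiff (nbhd e v) (nbhd e q)| <= n)%N.
  have [vQ|vQ] := boolP (v \in Q).
    by exists v; rewrite vQ symdiffxx cards0 muln0.
  apply/existsP; apply: contraT => /existsPn hfar.
  have far q : q \in Q -> (n <= h * #|symdiff (nbhd e v) (nbhd e q)|)%N.
    by move=> qQ; have := hfar q; rewrite qQ /= -ltnNge => /ltnW.
  have : separated e h (v |: Q).
    apply/forall_inP => x; rewrite !inE => hx; apply/forall_inP => y; rewrite !inE => hy.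
    apply/implyP => xy; case/orP: hx => [/eqP hx|hx]; case/orP: hy => [/eqP hy|hy].
    - by rewrite hx hy eqxx in xy.
    - by rewrite hx far.
    - by rewrite hy symdiffC far.
    - by have /forall_inP/(_ _ hx)/forall_inP/(_ _ hy)/implyP/(_ xy) := sepQ.
  by move=> /maxQ; rewrite cardsU1 vQ ltnn.
have [f hf] := choice close; exists f; split.
  apply: leq_ltn_trans (card_separated_lt simple noVC h0 k0 sepQ).
  apply: subset_leq_card; apply/subsetP => x /imsetP[v _ ->].
  by case/andP: (hf v).
move=> v w vw; have /andP[_ hv] := hf v; have /andP[_ hw] := hf w.
rewrite vw in hv; apply: leq_trans (leq_mul (leqnn h) (symdiff_triangle _ (nbhd e (f w)) _)) _.
by rewrite mulnDr mul2n -addnn leq_add // symdiffC.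
Qed.
End ClosePartition.

(** * Variance of the edge indicator on close cells *)

Lemma le_average (R : realType) (Om S : finType) (phi psi : Om -> R) (F : Om -> S) w :
  (forall w', F w' = F w -> phi w' <= psi w') -> average phi F w <= average psi F w.
Proof.
move=> h; rewrite /average ler_wpM2r ?invr_ge0 //.
by apply: ler_sum => w' /eqP /h.
Qed.

Lemma average_cst (R : realType) (Om S : finType) (c : R) (F : Om -> S) w :
  average (fun=> c) F w = c.
Proof.
rewrite /average sumr_const cardsE -[c *+ _]mulr_natr mulfK // pnatr_eq0 -lt0n.
by apply/card_gt0P; exists w; apply/eqP.
Qed.

Lemma averageD (R : realType) (Om S : finType) (phi psi : Om -> R) (F : Om -> S) w :
  average (fun w => phi w + psi w) F w = average phi F w + average psi F w.
Proof. by rewrite /average big_split mulrDl. Qed.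

Lemma average_sum (R : realType) (Om S I : finType) (phi : I -> Om -> R) (F : Om -> S) w :
  average (fun w => \sum_i phi i w) F w = \sum_i average (phi i) F w.
Proof. by rewrite /average exchange_big mulr_suml. Qed.

Lemma sum_average (R : realType) (Om S : finType) (phi : Om -> R) (F : Om -> S) :
  \sum_w average phi F w = \sum_w phi w.
Proof.
have := sum_average_mul phi (F := F) (u := fun=> 1) (fun _ _ _ => erefl).
by under eq_bigr do rewrite mulr1; under [in RHS]eq_bigr do rewrite mulr1.
Qed.

Lemma average_square (R : realType) n (T : finType) (f : 'I_n -> T)
    (phi : 'I_n * 'I_n -> R) x y :
  average phi (square f) (x, y) =
  average (fun x' => average (fun y' => phi (x', y')) f y) f x.
Proof.
rewrite /average -mulr_suml -mulrA -invfM -natrM; congr (_ / _%:R).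
  rewrite pair_big; apply: eq_big => -[x' y'] //=.
rewrite mulnC -cardsX; apply: eq_card => -[x' y'].
by rewrite !inE xpair_eqE.
Qed.

Lemma sum_pairs (R : realType) n (F : 'I_n * 'I_n -> R) :
  \sum_p F p = \sum_x \sum_y F (x, y).
Proof. by rewrite pair_big; apply: eq_bigr => -[x y]. Qed.

Section Variance.
Variables (R : realType) (n : nat) (e : rel 'I_n) (f : 'I_n -> 'I_n) (h : nat).
Hypotheses (simple : simple_graph e) (h0 : (0 < h)%N).
Hypothesis close : forall v w, f v = f w ->
  (h * #|symdiff (nbhd e v) (nbhd e w)| <= 2 * n)%N.

Let edge (p : 'I_n * 'I_n) : R := (e p.1 p.2)%:R.
Let bound : R := 2 * n%:R / h%:R.

Lemma sum_disagree v w : f v = f w ->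
  \sum_y ((e v y != e w y)%:R : R) <= bound.
Proof.
move=> /close hvw; rewrite /bound ler_pdivlMr ?ltr0n // mulrC.
rewrite -natr_sum -!natrM ler_nat; apply: leq_trans hvw; rewrite leq_mul2l; apply/orP; right.
by rewrite -sum1dep_card [leqRHS]big_mkcond /=; apply: leq_sum => y _; rewrite !inE; case: (_ != _).
Qed.

Lemma sum_disagree_sym v w : f v = f w ->
  \sum_y ((e y v != e y w)%:R : R) <= bound.
Proof.
have [esym _] := simple; move=> /sum_disagree; apply: le_trans.
by apply: ler_sum => y _; rewrite ![e y _]esym.
Qed.

(* [d (1 - d)] is the probability that two pairs in the cell are an edge and a
   non-edge, in this order; changing one endpoint at a time bounds it. *)
Lemma sum_variance :
  \sum_p average edge (square f) p * (1 - average edge (square f) p) <= 4 * n%:R ^+ 2 / h%:R.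
Proof.
pose nonedge (p : 'I_n * 'I_n) : R := (~~ e p.1 p.2)%:R.
have hone p : 1 - average edge (square f) p = average nonedge (square f) p.
  rewrite -(average_cst 1 (square f) p).
  rewrite -[X in X - _](_ : average (fun q => edge q + nonedge q) (square f) p = _).
    by rewrite averageD addrAC subrr add0r.
  apply: (congr1 (fun phi => average phi (square f) p)); apply/funext => q.
  by rewrite /edge /nonedge; case: (e _ _); rewrite ?addr0 ?add0r.
rewrite sum_average_mul; last by move=> p q hpq; rewrite (average_eq edge hpq).
pose d1 (x x' y : 'I_n) : R := (e x y != e x' y)%:R.
pose d2 (x' y y' : 'I_n) : R := (e x' y != e x' y')%:R.
apply: (@le_trans _ _ (\sum_x \sum_y (average (fun x' => d1 x x' y) f x +
    average (fun x' => average (fun y' => d2 x' y y') f y) f x))).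
  rewrite sum_pairs; apply: ler_sum => x _; apply: ler_sum => y _.
  rewrite hone average_square -averageD.
  have h1 : 0 <= edge (x, y) <= 1 by rewrite /edge; case: (e _ _); rewrite ?lexx ?ler01.
  rewrite /edge /=; case exy : (e x y); last first.
    rewrite mul0r; apply: divr_ge0 => //; apply: sumr_ge0 => x' _; apply: addr_ge0 => //.
    by apply: divr_ge0 => //; apply: sumr_ge0.
  rewrite mul1r; apply: le_average => x' _.
  rewrite -(average_cst (d1 x x' y) f y) -averageD; apply: le_average => y' _.
  rewrite /nonedge /d1 /d2 /= exy; by case: (e x' y); case: (e x' y') => /=; lra.
have hn2 : \sum_(x < n) bound = 2 * n%:R ^+ 2 / h%:R.
  by rewrite sumr_const card_ord -mulr_natr /bound expr2; ring.
have -> : 4 * n%:R ^+ 2 / h%:R = \sum_(x < n) bound + \sum_(x < n) bound by rewrite hn2; ring.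
under eq_bigr do rewrite big_split /=.
rewrite big_split /=; apply: lerD.
  apply: ler_sum => x _; rewrite -average_sum -[leRHS](average_cst bound f x).
  by apply: le_average => x' hx; apply: sum_disagree.
rewrite exchange_big /=.
under eq_bigr do rewrite sum_average.
apply: ler_sum => y _; rewrite -average_sum -[leRHS](average_cst bound f y).
by apply: le_average => y' hy; apply: sum_disagree_sym.
Qed.
End Variance.

(** * Pairs of density close to 0 or 1 *)

Section NearlyConstant.
Variables (R : realType) (n : nat) (X Y X' Y' : {set 'I_n}) (eps : R).
Hypotheses (X0 : (0 < #|X|)%N) (Y0 : (0 < #|Y|)%N) (eps0 : 0 < eps).
Hypotheses (sX : X' \subset X) (sY : Y' \subset Y).
Hypotheses (cX : eps * #|X|%:R <= #|X'|%:R) (cY : eps * #|Y|%:R <= #|Y'|%:R).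

Lemma large_subset_gt0 (A B : {set 'I_n}) : (0 < #|A|)%N -> eps * #|A|%:R <= #|B|%:R ->
  (0 < #|B|)%N.
Proof. by move=> A0; rewrite -(ltr_nat R); apply: lt_le_trans; rewrite mulr_gt0 ?ltr0n. Qed.

Lemma density_ge0 (e : rel 'I_n) (A B : {set 'I_n}) : 0 <= density R e A B.
Proof. by rewrite divr_ge0. Qed.

Lemma density_compl (e : rel 'I_n) (A B : {set 'I_n}) : (0 < #|A|)%N -> (0 < #|B|)%N ->
  density R (fun x y => ~~ e x y) A B = 1 - density R e A B.
Proof.
move=> A0 B0; have AB : (#|A| * #|B|)%:R != 0 :> R by rewrite pnatr_eq0 -lt0n muln_gt0 A0.
apply: (mulIf AB); rewrite /density mulrBl mul1r !divfK //.
rewrite -cardsX -(cardsID [set p | e p.1 p.2] (finset.setX A B)) natrD.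
set E := #|[set p in _ | e _ _]|; have -> : #|finset.setX A B :&: [set p | e p.1 p.2]| = E.
  by apply: eq_card => p; rewrite !inE.
rewrite addrC addKr; congr _%:R; apply: eq_card => p; rewrite !inE andbC //.
Qed.

(** [X'] and [Y'] span at least a share [eps ^+ 2] of all pairs, so the density grows at most by the
    inverse of this share. *)
Lemma density_sub_le (e : rel 'I_n) : density R e X Y <= eps ^+ 3 -> density R e X' Y' <= eps.
Proof.
have pos (A B : {set 'I_n}) : (0 < #|A|)%N -> (0 < #|B|)%N -> 0 < (#|A| * #|B|)%:R :> R.
  by move=> *; rewrite ltr0n muln_gt0; apply/andP.
have X'0 := large_subset_gt0 X0 cX; have Y'0 := large_subset_gt0 Y0 cY.
rewrite /density !ler_pdivrMr ?pos // => h1.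
apply: (@le_trans _ _ #|[set p in finset.setX X Y | e p.1 p.2]|%:R).
  rewrite ler_nat; apply: subset_leq_card; apply/subsetP => p; rewrite !inE.
  by move=> /andP[/andP[/(subsetP sX) -> /(subsetP sY) ->] ->].
apply: le_trans h1 _; rewrite [eps ^+ 3]exprS -mulrA ler_pM2l // !natrM expr2 mulrACA.
by apply: ler_pM => //; rewrite mulr_ge0 // ltW.
Qed.
End NearlyConstant.

(** The hypothesis puts [d] or [1 - d] below [eps ^+ 3]. Then [density_sub_le], for [e] or its
    complement, places both densities in one interval of length [eps]. *)
Lemma regular_of_variance (R : realType) n (e : rel 'I_n) (X Y : {set 'I_n}) (eps : R) :
  (0 < #|X|)%N -> (0 < #|Y|)%N -> 0 < eps -> eps <= 1 ->
  density R e X Y * (1 - density R e X Y) <= eps ^+ 3 / 2 -> regular_pair e eps X Y.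
Proof.
move=> X0 Y0 eps0 eps1 hvar; apply/forallP => X'; apply/forallP => Y'; apply/implyP.
move=> /and4P[sX sY cX cY].
have X'0 := large_subset_gt0 eps0 X0 cX; have Y'0 := large_subset_gt0 eps0 Y0 cY.
have e3 : eps ^+ 3 <= eps by rewrite -[leRHS]expr1; apply: ler_wiXn2l => //; apply: ltW.
have d0 := density_ge0 R e X Y; have d0' := density_ge0 R e X' Y'.
have c0 := density_ge0 R (fun x y => ~~ e x y) X Y.
have c0' := density_ge0 R (fun x y => ~~ e x y) X' Y'.
have low := density_sub_le X0 Y0 eps0 sX sY cX cY (e := e).
have high := density_sub_le X0 Y0 eps0 sX sY cX cY (e := fun x y => ~~ e x y).
rewrite !density_compl // in c0 c0' high.
rewrite ler_norml; move: (density R e X Y) (density R e X' Y') hvar d0 d0' c0 c0' low high.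
move=> d d' hvar d0 d0' c0 c0' low high.
have [dh|dh] := lerP d (1 / 2).
  have hd : d <= eps ^+ 3 by nra.
  by have := low hd; lra.
have hd : 1 - d <= eps ^+ 3 by nra.
by have := high hd; lra.
Qed.

(** Markov's inequality: an irregular pair has [d * (1 - d)] above [eps ^+ 3 / 2], the total is at
    most [4 * n ^ 2 / h], and [8 <= h * eps ^+ 4] turns the quotient into [eps * n ^ 2]. *)
Lemma bounded_VC_regular (R : realType) n (e : rel 'I_n) (k h : nat) (eps : R) :
  simple_graph e -> ~ vc_witness e k -> (0 < k)%N -> 0 < eps -> eps <= 1 ->
  8 <= h%:R * eps ^+ 4 ->
  exists P, regular_partition e eps P /\ (#|P| <= 2 ^ (16 * (h * k) * k))%N.
Proof.
move=> simple noVC k0 eps0 eps1 heps.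
have h0 : (0 < h)%N by rewrite lt0n; apply: contraTneq heps => ->; rewrite mul0r -ltNge.
have [f [hcard hclose]] := exists_close_partition simple noVC h0 k0.
exists (preim_partition f [set: 'I_n]); split; last first.
  exact: leq_trans (card_preim_partition f) (ltnW hcard).
rewrite regular_preim; set B := [set p | _].
have := sum_variance R simple h0 hclose; set d := average _ _.
have fibre0 v : (0 < #|fibre f (f v)|)%N by apply/card_gt0P; exists v; rewrite inE.
have d01 p : 0 <= d p * (1 - d p).
  by rewrite /d average_density mulr_ge0 ?density_ge0 // -density_compl ?density_ge0.
rewrite (bigID (mem B)) /= => hle.
have : #|B|%:R * (eps ^+ 3 / 2) <= 4 * n%:R ^+ 2 / h%:R.
  apply: le_trans hle; rewrite mulr_natl -sumr_const -[leLHS]addr0; apply: lerD.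
    apply: ler_sum => p; rewrite inE => hp; rewrite leNgt; apply: contra hp => /ltW hp.
    by apply: regular_of_variance => //; rewrite -average_density.
  exact: sumr_ge0.
have hpos : 0 < h%:R :> R by rewrite ltr0n.
rewrite ler_pdivlMr // natrX => h1.
have n2 : 0 <= n%:R ^+ 2 :> R by apply: sqr_ge0.
have e3 : 0 < eps ^+ 3 by rewrite exprn_gt0.
have e4 : eps ^+ 4 = eps * eps ^+ 3 by rewrite exprS.
have : 8 * #|B|%:R <= 8 * (eps * n%:R ^+ 2).
  apply: (@le_trans _ _ (h%:R * eps ^+ 4 * #|B|%:R)); first by rewrite ler_wpM2r.
  rewrite e4; have := ler_wpM2l (ltW eps0) h1; lra.
by rewrite ler_pM2l.
Qed.

(** * Comparison with the tower function *)

Section TowerGrowth.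
Variable R : realType.

Lemma leq_self_tw i : (i <= tw i)%N.
Proof.
elim: i => // -[|i] IH //.
by apply: leq_trans (ltn_expl (tw i.+1) (isT : 1 < 2)%N); rewrite ltnS.
Qed.

Lemma natr_ceil (x : R) : 0 <= x -> (`|Num.ceil x|%N)%:R = (Num.ceil x)%:~R :> R.
Proof.
move=> x0; rewrite natr_absz ger0_norm // ceil_ge0.
by apply: lt_le_trans x0; rewrite oppr_lt0.
Qed.

Lemma ceil_nat_ge (x : R) : 0 <= x -> x <= (`|Num.ceil x|%N)%:R.
Proof. by move=> x0; rewrite natr_ceil // ceil_ge. Qed.

Lemma ceil_nat_lt (x : R) : 0 <= x -> (`|Num.ceil x|%N)%:R < x + 1.
Proof.
by move=> x0; have := ceilB1_lt x; rewrite natr_ceil // intrB ltrBlDr.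
Qed.

Lemma tw_le_twR n (x : R) : n%:R <= x -> (tw n <= twR x)%N.
Proof.
move=> h; apply: leq_tw; rewrite -(ler_nat R); apply: (le_trans h); apply: ceil_nat_ge.
exact: le_trans h.
Qed.

Lemma half_tower_ge r : (3 <= r)%N -> (r + 10 <= half_tower r)%N.
Proof.
elim: r => // r IH; rewrite leq_eqVlt => /orP[/eqP [<-]|].
  by vm_compute.
rewrite ltnS => /IH h /=.
have := half_tower_gt0 r; move: (half_tower r) h => z h z0.
have : (2 ^ 1 <= 2 ^ z)%N by rewrite leq_exp2l.
rewrite expn1; move: (2 ^ z)%N => w hw; nia.
Qed.

(** One exponential step of [half_tower] absorbs the factor [1024 * s] lost in [card_parts_ge]. *)
Lemma tw_mul_le_half_tower r : (3 <= r)%N -> (tw r.+1 * (1024 * r.+1) <= half_tower r.+1)%N.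
Proof.
move=> r3; apply: leq_mul; first exact: tw_le_half_tower.
apply: (@leq_trans (2 ^ (10 + r))); last by rewrite leq_exp2l // addnC half_tower_ge.
by rewrite expnD; apply: leq_mul => //; apply: ltn_expl.
Qed.

Lemma exp_beats_poly (c D B : nat) :
  exists2 i, (B <= i)%N & (c * (i + 3) ^ D < 2 ^ i)%N.
Proof.
(* With i = 2^z, the power of i + 3 is at most 2^((z+2)D), and it remains to compare exponents: c +
   (z+2)D <= (w+1)^2 <= 2^z. *)
pose w := (c + 2 * D + B)%N; pose z := (2 * w)%N.
have hw : (w.+1 <= 2 ^ w)%N by apply: ltn_expl.
have hz : (w.+1 * w.+1 <= 2 ^ z)%N by rewrite /z mul2n -addnn expnD leq_mul.
exists (2 ^ z)%N; first by apply: leq_trans hz; rewrite /w; nia.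
apply: (@leq_trans (2 ^ c * 2 ^ (z.+2 * D))).
  rewrite -ltnS -addn1; apply: (@leq_trans (c.+1 * 2 ^ (z.+2 * D)).+1); last first.
    by rewrite ltnS leq_mul // ltn_expl.
  rewrite addn1 !ltnS mulSn; apply: (@leq_trans (c * 2 ^ (z.+2 * D)).+1); last first.
    by rewrite -add1n leq_add2r expn_gt0.
  rewrite ltnS leq_mul2l expnM; apply/orP; right.
  have h4 : (2 ^ z + 3 <= 2 ^ z.+2)%N.
    have : (0 < 2 ^ z)%N by rewrite expn_gt0.
    by rewrite !expnS; lia.
  by case: (D) => // D'; rewrite leq_exp2r.
rewrite -expnD leq_exp2l //; apply: leq_trans hz; rewrite /z /w; nia.
Qed.

End TowerGrowth.

(** * Tower bounds for [M_H] *)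

Section MH.
Variables (R : realType) (H : gclass).

(** One bound [M] guarantees a least one, so [M_H] is this minimum and not the default value of
    [xget]. *)
Lemma M_H_spec (eps : R) M : M_bound H eps M -> M_bound H eps (M_H H eps) /\ (M_H H eps <= M)%N.
Proof.
move=> hM; have ex : exists m, `[< M_bound H eps m >] by exists M; apply/asboolP.
have [m /asboolP hm hmin] := ex_minnP ex.
have : M_bound H eps (M_H H eps) /\ forall M', M_bound H eps M' -> (M_H H eps <= M')%N.
  apply: (@classical_sets.xgetPex _ 0%N (fun M => M_bound H eps M /\
    forall M', M_bound H eps M' -> (M <= M')%N)).
  by exists m; split=> // M' /asboolP; apply: hmin.
by move=> [h1 h2]; split=> //; apply: h2.
Qed.

Lemma M_bound_tower (eps : R) (j : nat) : 0 < eps -> 1 < eps ^+ 5 *+ j ->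
  M_bound H eps (tw (2 * j).+2).
Proof. by move=> eps0 hj; exists 1%N => n e n1 _; apply: szemeredi. Qed.

End MH.

(** For the lower bound, [s] is about [eps] to the power -1/8, while [M_bound_ge] only needs [eps]
    below a constant times [s] to the power -4. For the upper bound, about [eps] to the power -5
    rounds suffice, and the spare factor [1 / eps] absorbs the constants. *)
Lemma tower_bounds (R : realType) (H : gclass) (eps : R) : hereditary H -> infinite_VC H ->
  0 < eps -> eps < (512 ^+ 8)^-1 ->
  (twR (powR eps (- 8^-1)) <= M_H H eps <= twR (powR eps (- 6)))%N.
Proof.
move=> hH hVC eps0 hsmall; pose x := powR eps (- 8^-1); pose y := x^-1.
have x0 : 0 < x by apply: powR_gt0.
have y0 : 0 < y by rewrite invr_gt0.
have x8 : x ^+ 8 = eps^-1.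
  rewrite -powR_mulrn ?(ltW x0) // -powRrM (_ : - 8^-1 * 8%:R = -1); last by field.
  by rewrite powR_inv1 // ltW.
have epsE : eps = y ^+ 8 by rewrite /y exprVn x8 invrK.
have x512 : 512 < x.
  rewrite -(ltr_pXn2r (_ : 0 < 8)%N) ?nnegrE ?(ltW x0) // x8.
  by rewrite -ltf_pV2 ?posrE ?invrK ?invr_gt0 ?exprn_gt0.
have y512 : y < 512^-1 by rewrite ltf_pV2 ?posrE.
have [hupper hM] : M_bound H eps (M_H H eps) /\ (M_H H eps <= twR (powR eps (- 6)))%N.
  have e5 : 0 < eps ^+ 5 by rewrite exprn_gt0.
  pose j := (`|Num.ceil (eps ^+ 5)^-1|%N).+1.
  have p5 : 0 <= (eps ^+ 5)^-1 by rewrite invr_ge0 ltW.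
  have hj : 1 < eps ^+ 5 *+ j.
    rewrite -mulr_natr -[ltLHS](divff (lt0r_neq0 e5)) ltr_pM2l //.
    by apply: le_lt_trans (ceil_nat_ge p5) _; rewrite ltr_nat.
  have [h1 h2] := M_H_spec (M_bound_tower H eps0 hj); split=> //.
  apply: leq_trans h2 _; apply: tw_le_twR.
  have hj2 : j%:R <= (eps ^+ 5)^-1 + 2.
    by rewrite /j -[leLHS]natr1; have := ceil_nat_lt p5; lra.
  rewrite powRN -[6]/(6%:R) powR_mulrn ?(ltW eps0) //.
  have eps6 : eps <= 6^-1.
    apply: (@le_trans _ _ y); last by apply: le_trans (ltW y512) _; rewrite lef_pV2 ?posrE // ler_nat.
    rewrite epsE -[leRHS]expr1; apply: ler_wiXn2l => //; first exact: ltW.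
    by apply: le_trans (ltW y512) _; rewrite invf_le1 // ler1n.
  have h6 : 6 <= eps^-1 by rewrite -[6]invrK lef_pV2 ?posrE ?invr_gt0.
  have h5 : 6 <= (eps ^+ 5)^-1.
    have eps1 : eps <= 1 by lra.
    apply: le_trans h6 _; rewrite lef_pV2 ?posrE // -[leRHS]expr1.
    by apply: ler_wiXn2l => //; apply: ltW.
  have -> : (eps ^+ 6)^-1 = eps^-1 * (eps ^+ 5)^-1 by rewrite exprS invfM.
  have -> : ((2 * j).+2)%:R = 2 * j%:R + 2 :> R by rewrite -addn2 natrD natrM.
  by nra.
rewrite hM andbT; pose s := `|Num.ceil x|%N.
have s_ge : x <= s%:R := ceil_nat_ge (ltW x0).
have s_le : s%:R <= 2 * x by have := ceil_nat_lt (ltW x0); rewrite -/s; lra.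
have s4 : (4 <= s)%N by rewrite -(ler_nat R); lra.
have s0 : 0 < s%:R :> R by rewrite ltr0n; lia.
have hu : eps <= (64 * s)%:R^-1 ^+ 4 / 32.
  (* As [eps] is [y ^+ 8], four factors [y] give [w ^+ 4], below the power of [(64 * s)^-1]; the
     other four, with the constants, are at most 4^-4 <= 1/32. *)
  pose w := y / 128.
  have w0 : 0 < w by rewrite divr_gt0.
  have wu : w <= (64 * s)%:R^-1.
    rewrite /w /y -invfM lef_pV2 ?posrE ?mulr_gt0 // natrM; lra.
  have w4 : w ^+ 4 <= (64 * s)%:R^-1 ^+ 4 by apply: lerXn2r; rewrite ?nnegrE ?invr_ge0 ?(ltW w0).
  have -> : eps = (128 * (128 * w)) ^+ 4 * w ^+ 4.
    by rewrite epsE /w; field.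
  have hw : 128 * (128 * w) <= 4^-1 by rewrite /w; lra.
  have : (128 * (128 * w)) ^+ 4 <= 4^-1 ^+ 4.
    have w1 : 0 <= 128 * (128 * w) by apply: mulr_ge0 => //; apply: mulr_ge0 => //; apply: ltW.
    by apply: lerXn2r; rewrite ?nnegrE // invr_ge0.
  have : 0 <= w ^+ 4 by rewrite exprn_ge0 ?ltW.
  have : (4^-1 ^+ 4 : R) <= 32^-1 by rewrite exprVn lef_pV2 ?posrE ?exprn_gt0 // -natrX ler_nat.
  move: ((128 * _) ^+ 4) (4^-1 ^+ 4) => a b; nra.
have := M_bound_ge hH hVC (leq_trans (isT : 0 < 4)%N s4) eps0 hu hupper.
have : (tw s * (1024 * s) <= half_tower s)%N.
  by case: (s) s4 => // r r3; apply: tw_mul_le_half_tower.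
move=> h1 h2; have := leq_trans h1 h2; rewrite leq_pmul2r // muln_gt0 /=.
exact: leq_trans s4.
Qed.

(** * Tower growth forces infinite VC-dimension *)

Lemma vc_witness_pred n (e : rel 'I_n) k : vc_witness e k.+1 -> vc_witness e k.
Proof.
move=> [a [b h]]; exists (fun i => a (lift ord0 i)),
  (fun s : {set 'I_k} => b [set lift ord0 i | i in s]).
by move=> i s; rewrite h mem_imset //; apply: lift_inj.
Qed.

(** Otherwise [M_H] is at most exponential in a power of [1 / eps], and a single small [eps] where
    the tower exceeds this gives a contradiction. *)
Lemma infinite_VC_of_tower (R : realType) (H : gclass) (C eps0 : R) :
  hereditary H -> 0 < C -> 0 < eps0 ->
  (forall eps : R, 0 < eps -> eps < eps0 -> (twR (powR eps (- C)) <= M_H H eps)%N) ->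
  infinite_VC H.
Proof.
move=> [simple hered] C0 e0 htw; apply: contrapT => /existsNP[k0 hk].
pose k := k0.+1.
have noVC n (e : rel 'I_n) : H n e -> ~ vc_witness e k.
  by move=> He /vc_witness_pred hw; apply: hk; exists n, e.
(* Since [d * C >= 1], taking [eps] to be [y] to the power [-d] makes the assumed lower bound at
   least [tw y]. *)
pose d := (`|Num.ceil C^-1|%N).+1.
have dC : 1 <= d%:R * C.
  rewrite -ler_pdivrMr // div1r.
  apply: le_trans (ceil_nat_ge _) _; first by rewrite invr_ge0 ltW.
  by rewrite ler_nat.
pose B := (`|Num.ceil eps0^-1|%N).+1.
have [i iB hi] := exp_beats_poly (128 * k * k) (4 * d) B.
(* The offset 3 exposes two exponentials, [tw y] being 2 to the power [2 ^ tw i.+1], with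
   [i <= tw i.+1]. The bound [B] on [i] puts [eps] below [eps0]. *)
pose y := (i + 3)%N.
have y1 : 1 < y%:R :> R by rewrite ltr1n /y addn3.
have y0 : 0 < y%:R :> R by apply: lt_trans y1.
pose eps : R := powR y%:R (- d%:R).
have epsE : eps = (y%:R ^+ d)^-1 by rewrite /eps powRN powR_mulrn // ltW.
have eps_gt0 : 0 < eps by apply: powR_gt0.
have yd : y%:R <= y%:R ^+ d :> R by rewrite -[leLHS]expr1 ler_weXn2l // ltW.
have eps_lt : eps < eps0.
  rewrite epsE -[ltRHS]invrK ltf_pV2 ?posrE ?invr_gt0 ?exprn_gt0 //.
  apply: lt_le_trans yd; apply: le_lt_trans (ceil_nat_ge _) _.
    by rewrite invr_ge0 ltW.
  by rewrite ltr_nat; apply: leq_trans iB _; rewrite leq_addr.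
have eps1 : eps <= 1 by rewrite epsE invf_le1 ?exprn_gt0 // (le_trans (ltW y1) yd).
pose h := (8 * y ^ (4 * d))%N.
have hheps : 8 <= h%:R * eps ^+ 4.
  rewrite epsE natrM natrX exprVn -exprM mulnC mulfK // expf_neq0 // lt0r_neq0 //.
have hM : M_bound H eps (2 ^ (16 * (h * k) * k))%N.
  exists 0%N => n e _ He.
  exact: bounded_VC_regular (simple _ _ He) (noVC _ _ He) _ eps_gt0 eps1 hheps.
have [_ hle] := M_H_spec hM.
have hlow : (tw y <= twR (powR eps (- C)))%N.
  apply: tw_le_twR; rewrite /eps -powRrM mulrNN.
  by rewrite -[leLHS]powRr1 ?(ltW y0) // ler_powR // ltW.
have := leq_trans hlow (leq_trans (htw _ eps_gt0 eps_lt) hle).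
rewrite /y addn3 -[tw i.+3]/(2 ^ 2 ^ tw i.+1)%N leq_exp2l // leqNgt => /negP; apply.
apply: (@leq_trans (2 ^ i)%N); last by rewrite leq_exp2l // (leq_trans (leqnSn i)) // leq_self_tw.
move: hi; rewrite -/y /h; move: (y ^ _)%N (2 ^ i)%N => z w; nia.
Qed.

(** * VC-dimension and the bipartite graphs U(k) *)

(** A [vc_witness] may use one vertex both as some [a i] and as some [b s]; the two copies of each
    vertex in the bipartite graph keep these roles apart. *)
Lemma infinite_VC_Bip (H : gclass) : hereditary H ->
  (forall k : nat, (1 <= k)%N -> in_Bip H (@U_adj k)) <-> infinite_VC H.
Proof.
move=> [simple _]; split=> [hU k|hVC k _]; last first.
  have [n [e [He [a [b hab]]]]] := hVC k; have [esym _] := simple _ _ He.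
  exists n, e; split=> //.
  exists (fun v => match v with inl i => inl (a i) | inr s => inr (b s) end); split.
    move=> [i|s] [j|t] // [h]; first by congr inl; apply/set1P; rewrite -hab h hab set11.
    by congr inr; apply/setP => i; rewrite -!hab h.
  by move=> [i|s] [j|t] //=; rewrite ?hab // esym hab.
have [n [G [HG [f [f_inj hf]]]]] := hU k.+1 isT; have [Gsym _] := simple _ _ HG.
(* Edges of [Bip G] change sides, and all the vertices used below lie in one
   component of [U k.+1]: keep the last index in every set. *)
pose base := f (inr [set: 'I_k.+1]); pose side (v : 'I_n + 'I_n) := if v is inl _ then true else false.
pose proj (v : 'I_n + 'I_n) := match v with inl x => x | inr x => x end.
have opp (u v : 'I_n + 'I_n) : bip_adj G u v -> side u = ~~ side v /\ G (proj u) (proj v).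
  by case: u => u; case: v => v //=; rewrite Gsym.
have adj (u v : 'I_n + 'I_n) : side u = ~~ side v -> bip_adj G u v = G (proj u) (proj v).
  by case: u => u; case: v => // v _ /=; rewrite Gsym.
have sa i : side (f (inl i)) = ~~ side base by apply: (opp _ _ _).1; rewrite -hf /= inE.
pose ext (s : {set 'I_k}) : {set 'I_k.+1} := ord0 |: [set lift ord0 i | i in s].
have sb s : side (f (inr (ext s))) = side base.
  have : side (f (inl ord0)) = ~~ side (f (inr (ext s))).
    by apply: (opp _ _ _).1; rewrite -hf /= !inE eqxx.
  by rewrite sa => /negb_inj.
exists n, G; split=> //.
exists (fun i => proj (f (inl (lift ord0 i)))), (fun s => proj (f (inr (ext s)))).
move=> i s; rewrite -adj; last by rewrite sa sb.
by rewrite -hf /= !inE /= mem_imset //; apply: lift_inj.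
Qed.

Theorem theorem1p14 (R : realType) (H : gclass) (hH : hereditary H) :
  [/\ ((exists (C C' : R), 0 < C /\ 0 < C' /\
         exists eps0 : R, 0 < eps0 /\
           forall eps : R, 0 < eps -> eps < eps0 ->
             (twR (powR eps (- C)) <= M_H H eps <= twR (powR eps (- C')))%N)
       <-> (forall k : nat, (1 <= k)%N -> in_Bip H (@U_adj k))),
      ((forall k : nat, (1 <= k)%N -> in_Bip H (@U_adj k)) <-> infinite_VC H)
    & ((exists (C C' : R), 0 < C /\ 0 < C' /\
         exists eps0 : R, 0 < eps0 /\
           forall eps : R, 0 < eps -> eps < eps0 ->
             (twR (powR eps (- C)) <= M_H H eps <= twR (powR eps (- C')))%N)
       <-> infinite_VC H)].
Proof.
have BV := infinite_VC_Bip hH.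
suff TV : (exists (C C' : R), 0 < C /\ 0 < C' /\
         exists eps0 : R, 0 < eps0 /\
           forall eps : R, 0 < eps -> eps < eps0 ->
             (twR (powR eps (- C)) <= M_H H eps <= twR (powR eps (- C')))%N)
       <-> infinite_VC H by split=> //; apply: iff_trans TV (iff_sym BV).
split=> [[C [C' [C0 [_ [eps0 [e0 htw]]]]]]|hVC].
  apply: (infinite_VC_of_tower hH C0 e0) => eps h1 h2.
  by case/andP: (htw eps h1 h2).
exists 8^-1, 6; rewrite invr_gt0; do 2!split=> //.
exists (512 ^+ 8)^-1; rewrite invr_gt0 exprn_gt0 //; split=> // eps h1 h2.
exact: tower_bounds.
Qed.
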